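(* Assume that $\alpha(x):=\max\{i>0: p_i\ge 1/x\}=x^{\theta}L(x)$ for some $\theta\in(0,1]$ and some function $L$ slowly varying at infinity. Let $k\ge1$ and let $A\in\mathcal{B}^{\mathrm{fin}}[0,1]$ with $|A|>0$. Then, almost surely as $n\to\infty$, $$\frac{R^*_{nA,k}}{\mathbb{E}R^*_{nA,k}}\to1,\qquad \frac{R_{nA,k}}{\mathbb{E}R_{nA,k}}\to1.$$
   Context: $\mathbb{Z}_+=\{1,2,\dots\}$. $X_1,X_2,\dots$ are i.i.d. $\mathbb{Z}_+$-valued random variables with $p_i:=\mathbb{P}(X_1=i)>0$ and $p_i\ge p_{i+1}$ for all $i\ge1$ ($X_j$ is the label of the urn hit by ball $j$). For $A\subseteq[0,1]$ and $n\ge1$, $nA=\{na:a\in A\}$; $R^*_{nA,k}$ is the number of urns $i\ge1$ for which at least $k$ indices $j\in nA\cap\mathbb{Z}_+$ satisfy $X_j=i$; and $R_{nA,k}:=R^*_{nA,k}-R^*_{nA,k+1}$ (the number of urns with exactly $k$ such indices). $\mathcal{B}^{\mathrm{fin}}[0,1]$ is the algebra of subsets of $[0,1]$ that are finite unions of intervals (including possibly isolated points). $|A|$ is Lebesgue measure. *)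

(* Defs.v *)
From HB Require Import structures.
From mathcomp Require Export all_boot all_order all_algebra finmap.
From mathcomp Require Export all_classical all_reals all_analysis.
Export Order.TTheory GRing.Theory Num.Theory.
Export numFieldNormedType.Exports.

Set Implicit Arguments.
Unset Strict Implicit.
Unset Printing Implicit Defensive.

Local Open Scope classical_set_scope.
Local Open Scope ring_scope.

Definition mutually_independent d d' (T : measurableType d)
    (T' : measurableType d') (R : realType) (P : probability T R)
    (I : choiceType) (D : set I) (X : I -> {RV P >-> T'}) : Prop :=
  forall J : {fset I}, [set` J] `<=` D ->
  forall B : I -> set T', (forall i, measurable (B i)) ->
  P (\bigcap_(i in [set` J]) (X i @^-1` B i)) =
    (\prod_(i <- J) P (X i @^-1` B i))%E.

(* Balls and urns are both labelled by the positive natural numbers, realised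
   inside [nat]; [X 0] plays no role. *)
Record iid_labels d (T : measurableType d) (R : realType) (P : probability T R)
    (X : nat -> {RV P >-> nat}) : Prop := {
  labels_gt0 : forall (j : nat) (w : T), (0 < j)%N -> (0 < X j w)%N ;
  labels_indep : mutually_independent [set j | (0 < j)%N] X ;
  labels_ident : forall j : nat, (0 < j)%N ->
    distribution P (X j) =1 distribution P (X 1%N) }.

Definition urn_prob d (T : measurableType d) (R : realType)
    (P : probability T R) (X : nat -> {RV P >-> nat}) (i : nat) : R :=
  fine (P [set w | X 1%N w = i]).

(* The set is finite for every [x > 0] when [p] is summable; the maximum of the
   empty set is [0]. *)
Definition alpha (R : realType) (p : nat -> R) (x : R) : nat :=
  \max_(i <- fset_set [set i : nat | (0 < i)%N /\ x^-1 <= p i]) i.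

Definition slowly_varying (R : realType) (L : R -> R) : Prop :=
  (exists x0 : R, measurable_fun `[x0, +oo[ L /\
     forall x : R, x0 <= x -> 0 < L x) /\
  forall t : R, 0 < t -> L (t * x) / L x @[x --> +oo] --> (1 : R).

Definition Bfin (R : realType) (A : set R) : Prop :=
  A `<=` `[0, 1] /\
  exists (m : nat) (I : 'I_m -> interval R), A = \bigcup_(l in setT) [set` I l].

(* the set nA `&` {1, 2, ...} *)
Definition ball_indices (R : realType) (A : set R) (n : nat) : set nat :=
  [set j | (0 < j)%N /\ [set n%:R * a | a in A] j%:R].

Definition ball_count (R : realType) (A : set R) (n : nat) (x : nat -> nat)
    (i : nat) : nat :=
  #|` fset_set [set j | ball_indices A n j /\ x j = i] |.

(* [x] is the sequence of labels. For [A] included in [0, 1] and [0 < k], only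
   finitely many balls and urns are counted, so that no junk value of
   [fset_set] intervenes. *)
Definition Rstar (R : realType) (A : set R) (n k : nat) (x : nat -> nat) : R :=
  (#|` fset_set [set i | (0 < i)%N /\ (k <= ball_count A n x i)%N] |)%:R.

Definition Rexact (R : realType) (A : set R) (n k : nat) (x : nat -> nat) : R :=
  Rstar A n k x - Rstar A n k.+1 x.

(* Main.v *)
Require Import Defs.
From mathcomp Require Import measurable_realfun ring lra zify.

(** The count of urns holding at least [k] balls of a finite set [J] of balls
    has a mean [mocc q #|J| k] that depends on [J] only through its size.
    Almost sure convergence of the ratio to 1 rests on four facts.

    Concentration.  Two urns being full are negatively correlated events
    ([btail2_le], by induction on the number of balls), so the variance
    of the count is at most its mean [M], and the relative variance at most
    [1 / M] ([occ_variance]).  If these bounds are summable along a sequence of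
    ball sets, the squared relative errors have an almost surely finite sum, so
    they vanish ([ae_cvg0_of_summable], [occ_ratio_ae]).

    Stability of the mean.  Deleting a random ball out of [m + 1] destroys a
    given [k]-tuple with probability [k / (m + 1)]; hence passing from [d] to
    [u] balls changes the mean by a relative amount of at most
    [k (u - d) / d] ([mocc_thinning_iter]).

    Interpolation.  The sets [n A] are not monotone in [n], but for [n] between
    two consecutive points of the mesh [j ^ C] they all lie between the set of
    balls common to all of them and the set of balls in some of them.  A ball in
    the difference crosses an endpoint of one of the intervals of [A], so the
    difference is small with respect to the mesh ([outer_inner_size],
    [blocks_size]).  Counts are monotone in the set of balls, so convergence on
    the two block sequences gives convergence for all [n]
    ([occ_sandwich], [occ_balls_lln]).

    Doubling.  Regular variation enters only through
    [alpha (2 n) >= rho * alpha n] for some [rho > 1] ([alpha_doubling]).  It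
    gives polynomial growth of the mean, hence the summability along the mesh
    for [C] large ([mocc_growth]).  It also shows that the urns of probability
    between [1 / (4 m)] and [1 / (2 m)], which hold exactly [k] balls with
    probability bounded below, are a positive proportion of those of probability
    at least [1 / (2 m)]; so the mean number of urns with exactly [k] balls is
    at least a constant times that of urns with at least [k] balls
    ([mocc_exact_ge]).  The exact count is a difference of two counts already
    controlled, and this lower bound keeps the relative error of the difference
    small ([cvg_ratio_of_sub]). *)

Set Implicit Arguments.
Unset Strict Implicit.
Unset Printing Implicit Defensive.
Local Open Scope classical_set_scope.
Local Open Scope ring_scope.

(** * Binomial tails and negative correlation *)

Section BinomialTail.
Variable R : realType.
Implicit Types (p q : R) (m k a b : nat).

(** The probability that a binomial variable with parameters [m] and [p] is at
    least [k], by conditioning on one trial.  The truncated predecessor is exact: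
    for [k = 0] the event is certain whatever the trial gives. *)
Fixpoint btail p m k : R :=
  if m is m'.+1 then p * btail p m' k.-1 + (1 - p) * btail p m' k
  else (k == 0)%N%:R.

(** The multinomial analogue: of [m] balls, each hitting a first urn with
    probability [p] and a second one with probability [q], at least [a] hit the
    first and at least [b] the second. *)
Fixpoint btail2 p q m a b : R :=
  if m is m'.+1 then
    p * btail2 p q m' a.-1 b + q * btail2 p q m' a b.-1
    + (1 - p - q) * btail2 p q m' a b
  else ((a == 0) && (b == 0))%N%:R.

Lemma btailk0 p m : btail p m 0 = 1.
Proof. by elim: m => //= m ->; ring. Qed.

Lemma btail_ge0 p m k : 0 <= p <= 1 -> 0 <= btail p m k.
Proof.
move=> /andP[p0 p1]; elim: m k => [k|m ih k] /=; first by rewrite ler0n.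
by rewrite addr_ge0 ?mulr_ge0 ?subr_ge0.
Qed.

Lemma btail_le1 p m k : 0 <= p <= 1 -> btail p m k <= 1.
Proof.
move=> /andP[p0 p1]; elim: m k => [k|m ih k] /=; first by rewrite lern1; case: eqP.
have q0 : 0 <= 1 - p by rewrite subr_ge0.
apply: (@le_trans _ _ (p * 1 + (1 - p) * 1)); last by lra.
by apply: lerD; apply: ler_wpM2l.
Qed.

Lemma btail_pred p m k : 0 <= p <= 1 -> btail p m k <= btail p m k.-1.
Proof.
move=> hp; move: (hp) => /andP[p0 p1].
elim: m k => [[|[|k]]|m ih k] //=.
apply: lerD; apply: ler_wpM2l; rewrite ?subr_ge0 //.
Qed.

Lemma btail_leS p m k : 0 <= p <= 1 -> btail p m k <= btail p m.+1 k.
Proof.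
move=> hp /=; have := btail_pred m k hp; move: hp => /andP[p0 p1].
by nra.
Qed.

Lemma btail_sub p m k :
  btail p m k - btail p m k.+1 = 'C(m, k)%:R * p ^+ k * (1 - p) ^+ (m - k).
Proof.
elim: m k => [|m ih] [|k]; rewrite /= ?btailk0.
- by rewrite bin0 expr0 !mul1r subr0.
- by rewrite bin0n mulr0n !mul0r subrr.
- have := ih 0%N; rewrite btailk0 !bin0 expr0 !mulr1 !mul1r !subn0 exprS => <-.
  by move: (btail p m 1) => g; ring.
- have e1 := ih k; have e2 := ih k.+1.
  transitivity (p * (btail p m k - btail p m k.+1)
      + (1 - p) * (btail p m k.+1 - btail p m k.+2)); first by ring.
  rewrite e1 e2 subSS binS natrD exprS.
  case: (ltnP k m) => km; last by rewrite (@bin_small m k.+1) //; ring.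
  by rewrite (_ : (m - k = (m - k.+1).+1)%N) ?exprS; [ring|lia].
Qed.

Lemma btail_le_bin p m k : 0 <= p <= 1 -> btail p m k <= 'C(m, k)%:R * p ^+ k.
Proof.
move=> /andP[p0 p1].
elim: m k => [|m ih] [|k]; rewrite ?btailk0 ?bin0 ?expr0 ?mulr1 //=.
  by rewrite bin0n mul0r.
have q0 : 0 <= 1 - p by rewrite subr_ge0.
have h1 := ler_wpM2l p0 (ih k); have h2 := ler_wpM2l q0 (ih k.+1).
apply: (le_trans (lerD h1 h2)); rewrite binS natrD exprS.
have : 0 <= p * ('C(m, k.+1)%:R * (p * p ^+ k)) by rewrite !mulr_ge0 ?exprn_ge0.
by nra.
Qed.

(** Delete one of [m.+1] trials at random: [k] given successes all survive with
    probability [(m + 1 - k) / (m + 1)].  In formulas, the increment in [m] is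
    [p] times a point mass, and [(m - k) 'C(m, k) = (k + 1) 'C(m, k + 1)] turns
    it into a point mass one step further. *)
Lemma btail_thinning p m k : 0 <= p <= 1 -> (k <= m)%N ->
  (m.+1 - k)%:R * btail p m.+1 k <= m.+1%:R * btail p m k.
Proof.
move=> hp; move: (hp) => /andP[p0 p1].
case: k => [|k] km; first by rewrite !btailk0 subn0.
have g1 := btail_ge0 m k.+2 hp.
have b1 := btail_sub p m k; have b2 := btail_sub p m k.+1.
have c : (m - k)%:R * 'C(m, k)%:R = k.+1%:R * 'C(m, k.+1)%:R :> R.
  by rewrite -!natrM mul_bin_left.
have e : (m.+1 - k.+1)%:R * (p * (btail p m k - btail p m k.+1))
    = k.+1%:R * (1 - p) * (btail p m k.+1 - btail p m k.+2).
  rewrite b1 b2 subSS (_ : (m - k = (m - k.+1).+1)%N); last by lia.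
  rewrite [in LHS]exprS -(_ : (m - k = (m - k.+1).+1)%N); last by lia.
  transitivity (((m - k)%:R * 'C(m, k)%:R) * p ^+ k.+1
    * ((1 - p) * (1 - p) ^+ (m - k.+1))).
    by rewrite exprS; ring.
  by rewrite c; ring.
rewrite [btail p m.+1 _]/=.
have -> : m.+1%:R = (m.+1 - k.+1)%:R + k.+1%:R :> R.
  by rewrite -natrD subnK // ltnS ltnW.
rewrite [leRHS]mulrDl -lerBlDl.
have -> : (m.+1 - k.+1)%:R * (p * btail p m k + (1 - p) * btail p m k.+1) -
  (m.+1 - k.+1)%:R * btail p m k.+1 =
  (m.+1 - k.+1)%:R * (p * (btail p m k - btail p m k.+1)) by ring.
rewrite e -mulrA; apply: ler_wpM2l => //.
have := btail_pred m k.+2 hp => /= h.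
by nra.
Qed.

Lemma btail2_0 p q m a : btail2 p q m a 0 = btail p m a.
Proof.
elim: m a => [|m ih] a /=; first by rewrite andbT.
by rewrite !ih; ring.
Qed.

(** Negative correlation of multinomial counts.  With [g], [h] the two marginal
    tails, the induction step loses
    [p q (g a.-1 - g a) (h b.-1 - h b)], which is nonnegative. *)
Lemma btail2_le p q m a b : 0 <= p -> 0 <= q -> p + q <= 1 ->
  btail2 p q m a b <= btail p m a * btail q m b.
Proof.
move=> p0 q0 pq; have hp : 0 <= p <= 1 by apply/andP; split=> //; lra.
have hq : 0 <= q <= 1 by apply/andP; split=> //; lra.
elim: m a b => [|m ih] a b /=; first by rewrite -natrM mulnb.
have r0 : 0 <= 1 - p - q by lra.
have h1 := ler_wpM2l p0 (ih a.-1 b); have h2 := ler_wpM2l q0 (ih a b.-1).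
have h3 := ler_wpM2l r0 (ih a b).
apply: (le_trans (lerD (lerD h1 h2) h3)); rewrite -subr_ge0.
have e1 := btail_pred m a hp; have e2 := btail_pred m b hq.
have : 0 <= (p * q) * ((btail p m a.-1 - btail p m a) * (btail q m b.-1 - btail q m b)).
  by rewrite !mulr_ge0 // subr_ge0.
by congr (0 <= _); ring.
Qed.

Lemma ffact_ge m k : ((m - k) ^ k <= m ^_ k)%N.
Proof.
elim: k m => // k ih [|m]; first by rewrite exp0n.
rewrite subSS ffactSS expnS leq_mul //; first by lia.
Qed.

(** Bernoulli's inequality: the factor [(1 - p) ^+ (m - k)] is at least 1/2. *)
Lemma binomial_point_ge p m k : 0 <= p -> (2 * m)%:R * p <= 1 ->
  'C(m, k)%:R * p ^+ k <= 2 * ('C(m, k)%:R * p ^+ k * (1 - p) ^+ (m - k)).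
Proof.
move=> p0 mp.
case: (ltnP m k) => km; first by rewrite bin_small // !mul0r mulr0.
case: m km mp => [|m] km mp.
  by move: km; rewrite leqn0 => /eqP ->; rewrite bin0 !expr0; lra.
have p1 : p <= 1.
  apply: le_trans mp; rewrite ler_peMl // ler1n; lia.
have B : forall n, 1 - n%:R * p <= (1 - p) ^+ n.
  elim=> [|n ih]; first by rewrite mul0r subr0 expr0.
  have q0 : 0 <= 1 - p by lra.
  rewrite exprS; apply: le_trans (ler_wpM2l q0 ih).
  have : 0 <= n%:R * (p * p) by rewrite !mulr_ge0.
  by rewrite -natr1; nra.
have h := B (m.+1 - k)%N.
have : (m.+1 - k)%:R * p <= m.+1%:R * p.
  by rewrite ler_wpM2r // ler_nat leq_subr.
move: mp; rewrite natrM => mp h2.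
have : 2^-1 <= (1 - p) ^+ (m.+1 - k) by lra.
have : 0 <= 'C(m.+1, k)%:R * p ^+ k by rewrite mulr_ge0 ?exprn_ge0.
by nra.
Qed.

End BinomialTail.

(** * Mean occupancy numbers *)

Lemma cvgn_ler (R : realType) (u v : nat -> R) (l l' : R) :
  u @ \oo --> l -> v @ \oo --> l' ->
  forall N, (forall n, (N <= n)%N -> u n <= v n) -> l <= l'.
Proof. by move=> ul vl N H; apply: ler_cvg_to ul vl _; exists N => // n /=; exact: H. Qed.

Section MeanOccupancy.
Variables (R : realType) (q : nat -> R).
Hypothesis q_ge0 : forall i, 0 <= q i.
Hypothesis q_sum : forall N, \sum_(0 <= i < N) q i <= 1.

(** The mean number of urns holding at least [k] out of [m] balls, when urn [i]
    has probability [q i]. *)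
Definition mocc m k : R := limn (series (fun i => btail (q i) m k)).

Lemma q01 i : 0 <= q i <= 1.
Proof.
rewrite q_ge0 /=; apply: le_trans (q_sum i.+1).
by rewrite big_nat_recr //= lerDr sumr_ge0.
Qed.
#[local] Hint Resolve q01 : core.

Lemma btail_lemul m k i : (0 < k)%N -> btail (q i) m k <= m%:R * q i.
Proof.
elim: k => // -[_ _|k ih _].
  by have := btail_le_bin m 1 (q01 i); rewrite bin1 expr1.
exact: le_trans (btail_pred m k.+2 (q01 i)) (ih _).
Qed.

Lemma mocc_cvg m k : (0 < k)%N ->
  series (fun i => btail (q i) m k) @ \oo --> mocc m k.
Proof.
move=> k0; suff : cvgn (series (fun i => btail (q i) m k)) by [].
apply: nondecreasing_is_cvgn.
  by apply: nondecreasing_series => i _ _; apply: btail_ge0.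
exists m%:R => _ [N _ <-]; rewrite /series /=.
apply: (@le_trans _ _ (\sum_(0 <= i < N) m%:R * q i)).
  by apply: ler_sum => i _; apply: btail_lemul.
by rewrite -mulr_sumr ler_piMr.
Qed.

Arguments mocc_cvg m {k}.

Lemma mocc_ge0 m k : (0 < k)%N -> 0 <= mocc m k.
Proof.
move=> k0; have c0 : (fun _ : nat => 0 : R) @ \oo --> (0 : R) by exact: cvg_cst.
apply: (cvgn_ler c0 (mocc_cvg m k0) (N := 0%N)) => N _.
by rewrite /series /= sumr_ge0 // => i _; apply: btail_ge0.
Qed.

Lemma sum_indic_lt N M : (N <= M)%N -> \sum_(0 <= i < M) (i < N)%N%:R = N%:R :> R.
Proof.
move=> NM; rewrite (big_cat_nat (leq0n N) NM) //= [X in _ + X]big_nat_cond.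
rewrite [X in _ + X]big1 ?addr0.
  rewrite big_nat (eq_bigr (fun=> 1)); last by move=> i /andP[_ ->].
  by rewrite -big_nat sumr_const_nat subn0.
by move=> i; rewrite andbT => /andP[h _]; rewrite ltnNge h.
Qed.

(** Comparisons of mean occupancies reduce to one urn at a time, with a possible
    bounded contribution from each of finitely many urns. *)
Lemma mocc_ineq m k (N1 N2 : nat) (c1 c2 : R) : (0 < k)%N ->
  (forall i, (i < N1)%N%:R + c1 * btail (q i) m k <=
    (i < N2)%N%:R + c2 * (btail (q i) m k - btail (q i) m k.+1)) ->
  N1%:R + c1 * mocc m k <= N2%:R + c2 * (mocc m k - mocc m k.+1).
Proof.
move=> k0 H; have h1 := mocc_cvg m k0; have h2 := mocc_cvg m (ltn0Sn k).
set S := fun k n => series (fun i => btail (q i) m k) n.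
have C1 : N1%:R + c1 * S k n @[n --> \oo] --> N1%:R + c1 * mocc m k.
  by apply: cvgD; [exact: cvg_cst|exact: cvgMl_tmp].
have C2 : N2%:R + c2 * (S k n - S k.+1 n) @[n --> \oo] -->
    N2%:R + c2 * (mocc m k - mocc m k.+1).
  by apply: cvgD; [exact: cvg_cst|apply: cvgMl_tmp; exact: cvgB].
apply: (cvgn_ler C1 C2 (N := (N1 + N2)%N)) => M NM.
rewrite /S /series /= -sumrB !mulr_sumr.
rewrite -(@sum_indic_lt N1 M) -?(@sum_indic_lt N2 M); try lia.
by rewrite -!big_split /=; apply: ler_sum => i _.
Qed.

Lemma mocc_leS m k : (0 < k)%N -> mocc m k <= mocc m.+1 k.
Proof.
move=> k0; apply: (cvgn_ler (mocc_cvg m k0) (mocc_cvg m.+1 k0) (N := 0%N)) => N _.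
by apply: ler_sum => i _; apply: btail_leS.
Qed.

Lemma mocc_homo k m n : (0 < k)%N -> (m <= n)%N -> mocc m k <= mocc n k.
Proof.
move=> k0; elim: n => [|n ih]; first by rewrite leqn0 => /eqP ->.
rewrite leq_eqVlt => /predU1P[-> //|mn].
exact: le_trans (ih mn) (mocc_leS n k0).
Qed.

Lemma mocc_pred m k : (0 < k)%N -> mocc m k.+1 <= mocc m k.
Proof.
move=> k0; apply: (cvgn_ler (mocc_cvg m (ltn0Sn k)) (mocc_cvg m k0) (N := 0%N)) => N _.
by apply: ler_sum => i _; apply: (btail_pred m k.+1 (q01 i)).
Qed.

Lemma mocc_thinning m k : (0 < k <= m)%N ->
  (m.+1 - k)%:R * mocc m.+1 k <= m.+1%:R * mocc m k.
Proof.
move=> /andP[k0 km].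
have S c n : c * series (fun i => btail (q i) n k) N @[N --> \oo] --> c * mocc n k.
  by apply: cvgMl_tmp; exact: mocc_cvg.
apply: (cvgn_ler (S _ _) (S _ _) (N := 0%N)) => N _.
rewrite /series /= !mulr_sumr.
by apply: ler_sum => i _; apply: btail_thinning.
Qed.

(** The mean is stable under a small relative change of the number of balls. *)
Lemma mocc_thinning_iter k d u : (0 < k <= d)%N -> (d <= u)%N ->
  (1 - k%:R * (u - d)%:R / d%:R) * mocc u k <= mocc d k.
Proof.
move=> /andP[k0 kd] /subnK <-; move: (u - d)%N => {u}x; rewrite addnK.
have d0 : 0 < d%:R :> R by rewrite ltr0n (leq_trans k0).
elim: x => [|x ih]; first by rewrite mulr0 mul0r subr0 mul1r.
have m1 := mocc_ge0 (x + d) k0; have m2 := mocc_ge0 (x.+1 + d) k0.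
have md := mocc_ge0 d k0.
(* A nonpositive factor makes the bound trivial; a positive one allows
   multiplying inequalities, as (1 - z x) (1 - z) >= 1 - z (x + 1). *)
case: (leP (1 - k%:R * x.+1%:R / d%:R : R) 0) => [h|h].
  by apply: le_trans md; rewrite mulr_le0_ge0.
have /mocc_thinning : (0 < k <= x + d)%N by rewrite k0 (leq_trans kd) ?leq_addl.
rewrite natrB; last by rewrite (leq_trans kd) // leqW ?leq_addl.
set M : R := (x + d).+1%:R => hh.
have M0 : d%:R <= M by rewrite ler_nat leqW ?leq_addl.
have Mp : 0 < M by apply: lt_le_trans M0.
have e1 : (1 - k%:R / d%:R) * mocc (x.+1 + d) k <= mocc (x + d) k.
  apply: (@le_trans _ _ ((1 - k%:R / M) * mocc (x.+1 + d) k)).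
    rewrite ler_wpM2r // lerB // ler_wpM2l // lef_pV2 ?posrE //.
  rewrite -(ler_pM2l Mp) mulrA mulrBr mulr1 mulrCA divff ?mulr1 ?gt_eqF //.
set z := k%:R / d%:R in e1 *; have z0 : 0 <= z by rewrite divr_ge0.
have e2 : k%:R * x.+1%:R / d%:R = z * x%:R + z.
  by rewrite /z -natr1; field; rewrite gt_eqF.
have e3 : k%:R * x%:R / d%:R = z * x%:R.
  by rewrite /z; field; rewrite gt_eqF.
rewrite e3 in ih; rewrite e2 in h *.
have x0 : 0 <= z * x%:R by rewrite mulr_ge0.
have : (1 - z * x%:R) * ((1 - z) * mocc (x.+1 + d) k) <= (1 - z * x%:R) * mocc (x + d) k.
  by rewrite ler_wpM2l //; lra.
have : 0 <= (z * x%:R) * z * mocc (x.+1 + d) k by rewrite !mulr_ge0.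
nra.
Qed.

(* For nonincreasing q, the urns of probability at least 1 / m are those of
   index below some number, called a m here. *)
Variable a : nat -> nat.
Hypothesis aP : forall m i, (0 < m)%N -> (i < a m)%N = (1 <= m%:R * q i).

(** From ['C(m, k) q^k >= (m / 2)^k (4 m)^-k / k!] for [q >= 1 / (4 m)], and the
    factor 2 lost in [binomial_point_ge]. *)
Definition window_const (k : nat) : R := 2 * (8 ^ k * k`!)%:R.

Lemma window_const_gt0 k : 0 < window_const k.
Proof. by rewrite mulr_gt0 // ltr0n muln_gt0 expn_gt0 fact_gt0. Qed.

(** Urns of probability at least [1 / (2 m)] are counted by [a (2 * m)].  For the
    others ['C(m, k) q^k] is at least the tail and at most twice the point mass. *)
Lemma mocc_le_exact m k : (0 < m)%N -> (0 < k)%N ->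
  mocc m k <= (a (2 * m))%:R + 2 * (mocc m k - mocc m k.+1).
Proof.
move=> m0 k0; have := @mocc_ineq m k 0 (a (2 * m)) 1 2 k0.
rewrite add0r mul1r; apply => i; rewrite ltn0 add0r mul1r.
have b0 : 0 <= btail (q i) m k - btail (q i) m k.+1.
  by rewrite subr_ge0; apply: (btail_pred m k.+1 (q01 i)).
case: (boolP (i < _)%N) => [_|].
  by have := btail_le1 m k (q01 i); rewrite mulr1n; nra.
rewrite aP ?muln_gt0 // -ltNge => h; rewrite mulr0n add0r.
apply: le_trans (btail_le_bin m k (q01 i)) _; rewrite btail_sub.
by apply: binomial_point_ge => //; apply: ltW.
Qed.

(** An urn of probability between [1 / (4 m)] and [1 / (2 m)] holds exactly [k]
    of [m] balls with probability at least [1 / window_const k]. *)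
Lemma window_le_exact m k : (0 < k)%N -> (2 * k <= m)%N ->
  (a (4 * m))%:R <= (a (2 * m))%:R + window_const k * (mocc m k - mocc m k.+1).
Proof.
move=> k0 km; have m0 : (0 < m)%N by lia.
set c := window_const k.
have hw := window_const_gt0 k.
have := @mocc_ineq m k (a (4 * m)) (a (2 * m)) 0 c k0.
rewrite mul0r addr0; apply => i; rewrite mul0r addr0.
have b0 : 0 <= btail (q i) m k - btail (q i) m k.+1.
  by rewrite subr_ge0; apply: (btail_pred m k.+1 (q01 i)).
have cb0 : 0 <= c * (btail (q i) m k - btail (q i) m k.+1) by rewrite mulr_ge0 // ltW.
case: (boolP (i < a (2 * m))%N) => [_|].
  by rewrite -[leLHS]addr0 lerD // lern1 leq_b1.
rewrite aP ?muln_gt0 // -ltNge => h1.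
case: (boolP (i < a (4 * m))%N) => [|_]; last by rewrite mulr0n add0r.
rewrite aP ?muln_gt0 // => h2; rewrite mulr1n mulr0n add0r.
have hb := @binomial_point_ge R (q i) m k (q_ge0 i) (ltW h1); rewrite -btail_sub in hb.
rewrite /c /window_const natrM natrX.
have s1 : 1 <= (8 * (m - k)%:R * q i) ^+ k.
  rewrite exprn_ege1 //; apply: le_trans h2 _; rewrite natrM.
  apply: ler_wpM2r => //; rewrite -natrM -natrM ler_nat; lia.
have s2 : (m - k)%:R ^+ k <= k`!%:R * 'C(m, k)%:R :> R.
  by rewrite -natrX -natrM ler_nat mulnC bin_ffact ffact_ge.
have s3 : (8 * (m - k)%:R * q i) ^+ k <= 8 ^+ k * k`!%:R * ('C(m, k)%:R * q i ^+ k).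
  rewrite !exprMn -!mulrA ler_wpM2l ?exprn_ge0 // mulrA ler_wpM2r ?exprn_ge0 //.
have s4 : 0 <= 8 ^+ k * k`!%:R :> R by rewrite mulr_ge0 // exprn_ge0.
apply: le_trans s1 _; apply: le_trans s3 _.
by rewrite [X in _ <= X * _]mulrC -[leRHS]mulrA; apply: ler_wpM2l.
Qed.

Variables (rho : R) (n0 : nat).
Hypothesis rho1 : 1 < rho.
Hypothesis a_doubling : forall n, (n0 <= n)%N -> rho * (a n)%:R <= (a (2 * n))%:R.

(** Under doubling, [a (2 * m)] is at most a constant times
    [a (4 * m) - a (2 * m)], hence at most a constant times the mean number of
    urns with exactly [k] balls; [mocc_le_exact] then extends this to the whole
    mean. *)
Lemma mocc_exact_ge k : (0 < k)%N -> exists2 c : R, 0 < c &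
  forall m, (n0 + 2 * k <= m)%N ->
    c * mocc m k <= mocc m k - mocc m k.+1 /\ c * (a m)%:R <= mocc m k.
Proof.
move=> k0; set W := window_const k; have W0 : 0 < W := window_const_gt0 k.
have r0 : 0 < rho - 1 by rewrite subr_gt0.
have z0 : 0 < W / (rho - 1) by rewrite divr_gt0.
exists (W / (rho - 1) + 2)^-1; first by rewrite invr_gt0 addr_gt0.
move=> m hm; have m0 : (0 < m)%N by lia.
have Z0 : 0 < W / (rho - 1) + 2 by rewrite addr_gt0.
have h1 := mocc_le_exact m0 k0.
have /(window_le_exact k0) h2 : (2 * k <= m)%N by lia.
have hn : (n0 <= m)%N by lia.
have hn2 : (n0 <= 2 * m)%N by lia.
have h3 := a_doubling hn; have h4 := a_doubling hn2.
have D0 : 0 <= mocc m k - mocc m k.+1 by rewrite subr_ge0 mocc_pred.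
have M0 := mocc_ge0 m (ltn0Sn k).
rewrite (_ : 4 * m = 2 * (2 * m))%N in h2; last by lia.
set D := mocc m k - _ in h1 h2 D0 *.
have h5 : (a (2 * m))%:R <= W / (rho - 1) * D.
  rewrite mulrAC ler_pdivlMr //; rewrite -/W in h2; nra.
have ha : (a m)%:R <= (a (2 * m))%:R :> R.
  have : 0 <= (a m)%:R :> R by [].
  by nra.
rewrite ![_^-1 * _]mulrC !ler_pdivrMr // [_ * (_ + 2)]mulrC mulrDl.
split; first by lra.
have DM : D <= mocc m k by rewrite /D; lra.
have : 0 <= W / (rho - 1) * (mocc m k - D) by rewrite mulr_ge0 ?subr_ge0 // ltW.
by rewrite mulrC; nra.
Qed.

Lemma threshold_homo m n : (0 < m)%N -> (m <= n)%N -> (a m <= a n)%N.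
Proof.
move=> m0 mn; rewrite leqNgt; apply/negP => h.
have := h; rewrite aP // => h'.
suff : (a n < a n)%N by rewrite ltnn.
rewrite aP ?(leq_trans m0) //; apply: le_trans h' _.
by apply: ler_wpM2r; rewrite ?ler_nat.
Qed.

Hypothesis n0_gt0 : (0 < n0)%N.
Hypothesis a_n0 : (0 < a n0)%N.

(** Doubling means growth by a power of [n].  Raising to a large integer power [C]
    expresses this without real exponents. *)
Lemma threshold_growth : exists C : nat, exists2 c : R, 0 < c &
  (0 < C)%N /\ forall n, (n0 <= n)%N -> c * n%:R ^+ 2 <= (a n)%:R ^+ C.
Proof.
have r0 : 0 < rho - 1 by rewrite subr_gt0.
have B n : 1 + n%:R * (rho - 1) <= rho ^+ n.
  elim: n => [|n ih]; first by rewrite mul0r addr0 expr0.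
  rewrite exprS; have rp : 0 <= rho by lra.
  apply: le_trans (ler_wpM2l rp ih).
  have : 0 <= n%:R * ((rho - 1) * (rho - 1)) by rewrite !mulr_ge0 // ltW.
  by rewrite -natr1; nra.
(* 9 = 3 ^ 2, because n is at most 3 times its rounded half. *)
have [C hC] : exists C : nat, 9 <= rho ^+ C.
  have h9 : 0 <= 9 / (rho - 1) by rewrite divr_ge0 // ltW.
  have := archi_boundP h9; set C := Num.bound _ => hC; exists C.
  apply: le_trans (B C); rewrite ltr_pdivrMr // in hC; lra.
have C0 : (0 < C)%N by case: C hC => // ; rewrite expr0; lra.
have d0 : 0 < (2 * n0)%:R ^+ 2 :> R by rewrite exprn_gt0 // ltr0n muln_gt0.
exists C, ((2 * n0)%:R ^+ 2)^-1; first by rewrite invr_gt0.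
split => //; elim/ltn_ind => n ih hn.
have an : (0 < a n)%N by apply: leq_trans a_n0 (threshold_homo n0_gt0 hn).
case: (ltnP n (2 * n0)) => hn2.
  apply: (@le_trans _ _ 1).
    by rewrite mulrC ler_pdivrMr // mul1r ler_pXn2r ?nnegrE // ler_nat ltnW.
  by rewrite exprn_ege1 // ler1n.
have hh : (n0 <= n./2)%N by lia.
have hl : (n./2 < n)%N by lia.
have h1 := ih _ hl hh; have h2 := a_doubling hh.
have h3 : (a (2 * n./2) <= a n)%N by apply: threshold_homo; lia.
have h4 : rho * (a n./2)%:R <= (a n)%:R by apply: le_trans h2 _; rewrite ler_nat.
have rp : 0 <= rho by lra.
have h5 : rho ^+ C * (a n./2)%:R ^+ C <= (a n)%:R ^+ C.
  by rewrite -exprMn ler_pXn2r ?nnegrE // mulr_ge0.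
apply: le_trans h5; apply: le_trans (ler_wpM2l (exprn_ge0 C rp) h1).
rewrite [leRHS]mulrCA ler_wpM2l ?invr_ge0 ?(ltW d0) //.
apply: (@le_trans _ _ (9 * (n./2)%:R ^+ 2)); last by rewrite ler_wpM2r // exprn_ge0.
rewrite (_ : 9 = 3%:R ^+ 2); last by rewrite -natrX.
rewrite -exprMn ler_pXn2r ?nnegrE // -natrM ler_nat; lia.
Qed.

Lemma mocc_growth k : (0 < k)%N -> exists C : nat, exists2 c : R, 0 < c &
  (0 < C)%N /\ forall n, (n0 + 2 * k <= n)%N -> c * n%:R ^+ 2 <= mocc n k ^+ C.
Proof.
move=> k0; have [C [c c0 [C0 H]]] := threshold_growth.
have [e e0 E] := mocc_exact_ge k0.
exists C, (e ^+ C * c); first by rewrite mulr_gt0 // exprn_gt0.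
split=> // n hn; have [_ h] := E n hn.
have /H h2 : (n0 <= n)%N by lia.
have ep : 0 <= e ^+ C by rewrite exprn_ge0 // ltW.
rewrite -mulrA; apply: le_trans (ler_wpM2l ep h2) _.
by rewrite -exprMn ler_pXn2r ?nnegrE // ?mulr_ge0 ?mocc_ge0 // ltW.
Qed.

End MeanOccupancy.

(** * Joint law of the contents of two urns *)

Definition hits (x : nat -> nat) (J : seq nat) (i : nat) : nat :=
  count (fun j => x j == i) J.

Lemma leq_predLR a n : (a.-1 <= n)%N = (a <= n.+1)%N.
Proof. by case: a. Qed.

Section Labels.
Context d (T : measurableType d) (R : realType) (P : probability T R).
Variables (X : nat -> {RV P >-> nat}) (hX : iid_labels X).

Lemma measurable_label j (B : set nat) : measurable (X j @^-1` B).
Proof. by rewrite -[_ @^-1` _]setTI; apply: measurable_funP. Qed.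

Lemma label_prob j i : (0 < j)%N -> P (X j @^-1` [set i]) = (urn_prob X i)%:E.
Proof.
move=> j0; have := labels_ident hX j0 [set i].
rewrite /distribution /= /pushforward => ->.
by rewrite /urn_prob fineK // fin_num_measure //; exact: (measurable_label 1 [set i]).
Qed.

Lemma label_prob_compl2 j i1 i2 : (0 < j)%N -> i1 != i2 ->
  P (X j @^-1` ~` [set i1; i2]) = (1 - urn_prob X i1 - urn_prob X i2)%:E.
Proof.
move=> j0 i12; rewrite -preimage_setC probability_setC; last exact: measurable_label.
have -> : P (X j @^-1` [set i1; i2]) = (urn_prob X i1 + urn_prob X i2)%:E.
  rewrite preimage_setU EFinD -!(label_prob _ j0); apply: measureU;
    [exact: measurable_label|exact: measurable_label|].
  by rewrite -preimage_setI -subset0 => w /= [-> e]; move/eqP : i12.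
by rewrite -EFinB opprD addrA.
Qed.

Lemma measurable_hits J k i : measurable [set w | (k <= hits (fun j => X j w) J i)%N].
Proof.
elim: J k => [|j J ih] k /=.
  by case: (boolP (k <= 0)%N) => h;
    [rewrite (_ : [set _ | _] = setT)|rewrite (_ : [set _ | _] = set0)] => //;
    apply/seteqP; split => w //=; rewrite /hits /= ?(negbTE h).
rewrite (_ : [set _ | _] =
  ((X j @^-1` [set i]) `&` [set w | (k.-1 <= hits (fun j => X j w) J i)%N])
  `|` ((X j @^-1` ~` [set i]) `&` [set w | (k <= hits (fun j => X j w) J i)%N])).
  by apply: measurableU; apply: measurableI => //; apply: measurable_label.
apply/seteqP; split => w /=; rewrite /hits /=; case: eqP => e.
- by move=> h; left; split => //; lia.
- by rewrite add0n; right.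
- by move=> [[_ h]|[]//]; lia.
- by move=> [[]//|[_]].
Qed.

(** Induction on the list [J], splitting on the urn hit by its first ball.  The
    cylinder over [J'] is what makes the induction go through: the first ball
    moves from [J] to [J'], and independence is used only on cylinders, at the
    end. *)
Lemma hits_pair_tail i1 i2 (J : seq nat) (J' : {fset nat}) (B : nat -> set nat) a b :
  i1 != i2 -> uniq J -> all (ltn 0) J -> (forall j, j \in J' -> (0 < j)%N) ->
  (forall j, j \in J -> j \notin J') ->
  P ([set w | (a <= hits (fun j => X j w) J i1)%N && (b <= hits (fun j => X j w) J i2)%N]
     `&` \bigcap_(j in [set` J']) (X j @^-1` B j)) =
  ((btail2 (urn_prob X i1) (urn_prob X i2) (size J) a b)%:E *
   \prod_(j <- J') P (X j @^-1` B j))%E.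
Proof.
move=> i12; elim: J J' B a b => [|j J ih] J' B a b /=.
  move=> _ _ J'0 _.
  have Hi := labels_indep hX (J := J') J'0 (B := B) (fun=> Logic.I).
  rewrite -leqn0 -(leqn0 b).
  case: (boolP (_ && _)) => h; rewrite /hits /=.
    by rewrite (_ : [set _ | _] = setT) ?setTI ?mul1e //; apply/seteqP; split.
  rewrite (_ : [set _ | _] = set0) ?set0I ?measure0 ?mul0e //.
  by apply/seteqP; split => // w /=; rewrite (negbTE h).
move=> /andP[jJ uJ] /andP[j0 aJ] J'0 JJ'.
have jJ' : j \notin J' by apply: JJ'; rewrite inE eqxx.
pose B' c l := if l == j then c else B l.
pose E a b := [set w | (a <= hits (fun j => X j w) J i1)%N &&
                       (b <= hits (fun j => X j w) J i2)%N].
pose F := \bigcap_(j in [set` J']) (X j @^-1` B j).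
have IH c a' b' : P (E a' b' `&` ((X j @^-1` c) `&` F)) =
  ((btail2 (urn_prob X i1) (urn_prob X i2) (size J) a' b')%:E *
   (P (X j @^-1` c) * \prod_(j <- J') P (X j @^-1` B j)))%E.
  have -> : (X j @^-1` c) `&` F = \bigcap_(l in [set` (j |` J')%fset]) (X l @^-1` B' c l).
    apply/seteqP; split => w /=.
      move=> [h1 h2] l /=; rewrite !inE /B' => /orP[/eqP ->|lJ']; first by rewrite eqxx.
      by case: eqP => [->//|_]; apply: h2.
    move=> h; split.
      by have := h j; rewrite /B' /= !inE eqxx; apply.
    move=> l /= lJ'; have := h l; rewrite /B' /= !inE lJ' orbT.
    by case: eqP lJ' => [->|_ _]; [rewrite (negbTE jJ')|apply].
  rewrite (ih _ _ _ _ uJ aJ).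
  - congr (_ * _)%E; rewrite big_fsetU1 //= {1}/B' eqxx; congr (_ * _)%E.
    rewrite big_seq [RHS]big_seq; apply: eq_bigr => l lJ'.
    by rewrite /B'; case: eqP lJ' => [->|//]; rewrite (negbTE jJ').
  - by move=> l; rewrite !inE => /orP[/eqP ->//|]; apply: J'0.
  - move=> l lJ; rewrite !inE negb_or; apply/andP; split.
      by apply: contraNneq jJ => <-.
    by apply: JJ'; rewrite inE lJ orbT.
have mE a' b' : measurable (E a' b').
  rewrite (_ : E a' b' = [set w | (a' <= hits (fun j => X j w) J i1)%N]
    `&` [set w | (b' <= hits (fun j => X j w) J i2)%N]); last first.
    by apply/seteqP; split => w /=; [move/andP|move=> [h1 h2]; apply/andP].
  by apply: measurableI; apply: measurable_hits.
have mF : measurable F.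
  by apply: fin_bigcap_measurable => // l _; apply: measurable_label.
have mG c a' b' : measurable (E a' b' `&` ((X j @^-1` c) `&` F)).
  by apply: measurableI => //; apply: measurableI => //; apply: measurable_label.
rewrite (_ : _ `&` _ = (E a.-1 b `&` ((X j @^-1` [set i1]) `&` F)) `|`
   (E a b.-1 `&` ((X j @^-1` [set i2]) `&` F)) `|`
   (E a b `&` ((X j @^-1` ~` [set i1; i2]) `&` F))); last first.
  apply/seteqP; split => w /=; rewrite /hits /E /=.
  - move=> [/andP[h1 h2] hF]; case: (X j w =P i1) h1 h2 => e1.
      rewrite e1 (negbTE i12) !add0n add1n => h1 h2; left; left; split => //.
      by rewrite leq_predLR h1 h2.
    case: (X j w =P i2) => e2.
      rewrite !add0n add1n => h1 h2; left; right; split => //.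
      by rewrite leq_predLR h1 h2.
    by rewrite !add0n => h1 h2; right; split; [rewrite h1|split=> // -[]].
  - move=> [[[/andP[h1 h2] [-> hF]]|[/andP[h1 h2] [-> hF]]]|[/andP[h1 h2] [h3 hF]]]; split => //.
    + by rewrite eqxx (negbTE i12); move: h1 h2; rewrite /hits /= !leq_predLR => h1 h2; rewrite h1 h2.
    + by rewrite eqxx eq_sym (negbTE i12); move: h1 h2; rewrite /hits /= !leq_predLR => h1 h2; rewrite h1 h2.
    + by apply/andP; split; apply: leq_trans (leq_addl _ _).
set E1 := E a.-1 b `&` _; set E2 := E a b.-1 `&` _; set E3 := E a b `&` _.
have -> : P (E1 `|` E2 `|` E3) = (P E1 + P E2 + P E3)%E.
  transitivity (P (E1 `|` E2) + P E3)%E.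
    apply: measureU; [by apply: measurableU; apply: mG|exact: mG|].
    rewrite -subset0 => w /= [[[_ [e _]]|[_ [e _]]] [_ [h _]]]; apply: h; [by left|by right].
  congr (_ + _)%E; apply: measureU; [exact: mG|exact: mG|].
  by rewrite -subset0 => w /= [[_ [e _]] [_ [e' _]]]; move/eqP: i12; apply; rewrite -e -e'.
rewrite !IH !label_prob // label_prob_compl2 //.
set Q := (\prod_(_ <- _) _)%E.
have Qf : Q \is a fin_num.
  rewrite /Q; elim/big_rec: _ => [//|l x _ xf].
  by rewrite fin_numM // fin_num_measure //; exact: measurable_label.
rewrite -(fineK Qf) -!EFinM -!EFinD; congr (_%:E).
by ring.
Qed.

End Labels.

(** * Moments of the occupancy count *)

Definition occ (J : seq nat) (k : nat) (x : nat -> nat) : nat :=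
  #|` fset_set [set i | (0 < i)%N /\ (k <= hits x J i)%N]|.

Lemma hits_gt0 x J i : (0 < hits x J i)%N -> i \in map x J.
Proof.
rewrite -has_count => /hasP[j jJ /eqP <-]; exact: map_f.
Qed.

Lemma occ_count x J k N : (0 < k)%N -> (forall j, j \in J -> (x j <= N)%N) ->
  occ J k x = (\sum_(0 <= i < N) (k <= hits x J i.+1))%N.
Proof.
move=> k0 xN; rewrite /occ.
have -> : [set i | (0 < i)%N /\ (k <= hits x J i)%N] =
    [set` [fset i in [seq i <- iota 1 N | k <= hits x J i]%N]%fset].
  apply/seteqP; split => i /=; rewrite !inE mem_filter mem_iota.
    move=> [i0 h]; rewrite h i0 /= addnC addn1 ltnS.
    by have /hits_gt0/mapP[j jJ ->] := leq_trans k0 h; apply: xN.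
  by move=> /and3P[-> -> _].
rewrite set_fsetK card_fseq undup_id ?filter_uniq ?iota_uniq // size_filter.
move: {xN} N => N; elim: N => [|N ih]; first by rewrite big_geq.
by rewrite -[N.+1]addn1 iotaD count_cat ih addn1 big_nat_recr //= add1n addn0.
Qed.

Lemma finite_occ x J k : (0 < k)%N ->
  finite_set [set i | (0 < i)%N /\ (k <= hits x J i)%N].
Proof.
move=> k0; apply: (@sub_finite_set _ _ [set` map x J]); last exact: finite_seq.
by move=> i /= [_ h]; apply: hits_gt0; apply: leq_trans h.
Qed.

Lemma hits_subset x J1 J2 i : uniq J1 -> {subset J1 <= J2} ->
  (hits x J1 i <= hits x J2 i)%N.
Proof.
move=> u1 s12; rewrite /hits -!size_filter; apply: uniq_leq_size.
  exact: filter_uniq.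
by move=> j; rewrite !mem_filter => /andP[-> /s12].
Qed.

Lemma occ_subset x J1 J2 k : (0 < k)%N -> uniq J1 -> {subset J1 <= J2} ->
  (occ J1 k x <= occ J2 k x)%N.
Proof.
move=> k0 u1 s12; apply: fsubset_leq_card; apply/fsubsetP => i.
rewrite !in_fset_set; try exact: finite_occ.
by rewrite !inE => -[i0 h]; split => //; apply: leq_trans h (hits_subset _ _ u1 s12).
Qed.

Section Moments.
Context d (T : measurableType d) (R : realType) (P : probability T R).
Variables (X : nat -> {RV P >-> nat}) (hX : iid_labels X).

Let q i := urn_prob X i.+1.

Lemma urn_prob_ge0 i : 0 <= urn_prob X i.
Proof. exact/fine_ge0/measure_ge0. Qed.

Lemma urn_prob_sum N : \sum_(0 <= i < N) q i <= 1.
Proof.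
have H : P (X 1%N @^-1` [set i | (0 < i <= N)%N]) = (\sum_(0 <= i < N) q i)%:E.
  elim: N => [|N ih].
    rewrite big_geq // (_ : _ @^-1` _ = set0) ?measure0 //.
    by apply/seteqP; split => w //=; case: (X 1%N w).
  rewrite big_nat_recr //= EFinD -ih -(label_prob hX (j := 1%N)) //.
  rewrite (_ : [set i | (0 < i <= N.+1)%N] = [set i | (0 < i <= N)%N] `|` [set N.+1]).
    rewrite preimage_setU; apply: measureU; try exact: measurable_label.
    by rewrite -preimage_setI -subset0 => w /= [h e]; rewrite e ltnn andbF in h.
  apply/seteqP; split => i /=.
    by move=> /andP[i0]; rewrite leq_eqVlt => /predU1P[->|h]; [right|left; rewrite i0].
  by move=> [/andP[-> /leqW]|->]//=.
by rewrite -lee_fin -H probability_le1 //; exact: measurable_label.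
Qed.

Let E J k i := [set w | (k <= hits (fun j => X j w) J i.+1)%N].

Lemma hits_tail J k i : uniq J -> all (ltn 0) J ->
  P (E J k i) = (btail (q i) (size J) k)%:E.
Proof.
move=> uJ aJ.
have i12 : i.+1 != i.+2 by rewrite ltn_eqF.
have h0 : forall j, j \in fset0 -> (0 < j)%N by [].
have h1 : forall j, j \in J -> j \notin fset0 by [].
have := hits_pair_tail hX (fun=> setT) k 0 i12 uJ aJ h0 h1.
rewrite btail2_0 big_seq_fset0 mule1 => <-.
by congr (P _); apply/seteqP; split => w /=; [split => //; rewrite andbT|rewrite andbT => -[]].
Qed.

Lemma hits_pair_le J k i1 i2 : uniq J -> all (ltn 0) J -> i1 != i2 ->
  (P (E J k i1 `&` E J k i2) <= (btail (q i1) (size J) k * btail (q i2) (size J) k)%:E)%E.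
Proof.
move=> uJ aJ i12.
have i12' : i1.+1 != i2.+1 by rewrite eqSS.
have h0 : forall j, j \in fset0 -> (0 < j)%N by [].
have h1 : forall j, j \in J -> j \notin fset0 by [].
have := hits_pair_tail hX (fun=> setT) k k i12' uJ aJ h0 h1.
rewrite big_seq_fset0 mule1 => h.
rewrite (_ : E J k i1 `&` E J k i2 =
 [set w | (k <= hits (fun j => X j w) J i1.+1)%N && (k <= hits (fun j => X j w) J i2.+1)%N]
  `&` \bigcap_(j in [set` fset0]) X j @^-1` [set: nat]).
  rewrite h // lee_fin; apply: btail2_le; rewrite ?urn_prob_ge0 //.
  have := @label_prob_compl2 _ _ _ _ _ hX 1%N _ _ isT i12' => e.
  by rewrite -subr_ge0 opprD addrA -lee_fin -e measure_ge0.
apply/seteqP; split => w /=; first by move=> [-> ->].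
by move=> [/andP[]].
Qed.

Lemma mocc_eseries m k : (0 < k)%N ->
  (\sum_(i <oo) (btail (q i) m k)%:E)%E = (mocc q m k)%:E.
Proof.
move=> k0; rewrite -EFin_lim; last exact: (mocc_cvg (fun i => urn_prob_ge0 i.+1) urn_prob_sum).
by congr (limn _); apply/funext => N /=; rewrite sumEFin.
Qed.

Lemma occ_eseries J k w : (0 < k)%N ->
  (occ J k (fun j => X j w))%:R%:E = (\sum_(i <oo) (\1_(E J k i) w)%:E)%E :> \bar R.
Proof.
move=> k0; set x := fun j => X j w.
pose N := (\max_(j <- J) x j)%N.
have xN j : j \in J -> (x j <= N)%N.
  by move=> jJ; rewrite /N (big_rem j jJ) /= leq_maxl.
have Ei i : \1_(E J k i) w = (k <= hits x J i.+1)%N%:R :> R.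
  rewrite indicE; congr (nat_of_bool _)%:R.
  by apply/idP/idP; rewrite inE.
rewrite (nneseries_split 0 N); last by move=> i _; rewrite lee_fin.
rewrite add0n eseries0 ?adde0.
  rewrite (occ_count k0 xN) natr_sum sumEFin; congr (_%:E).
  by apply: eq_bigr => i _; rewrite Ei.
move=> i Ni _; rewrite Ei leqNgt; case: ltnP => // h.
have /hits_gt0/mapP[j jJ e] := leq_trans k0 h.
by have := xN _ jJ; rewrite -e ltnNge Ni.
Qed.

Lemma measurable_E J k i : measurable (E J k i).
Proof. exact: measurable_hits. Qed.

Lemma measurable_occ J k : (0 < k)%N ->
  measurable_fun setT (fun w => (occ J k (fun j => X j w))%:R : R).
Proof.
move=> k0; apply/measurable_EFinP.
rewrite [X in measurable_fun _ X](_ : _ =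
  (fun w => \sum_(i <oo) (\1_(E J k i) w)%:E)%E); last first.
  by apply/funext => w /=; rewrite occ_eseries.
apply: (ge0_emeasurable_sum (P := xpredT)); first by move=> i w _ _; rewrite lee_fin.
move=> i _; apply/measurable_EFinP; apply: measurable_indic; exact: measurable_E.
Qed.

Lemma integral_occ J k : (0 < k)%N -> uniq J -> all (ltn 0) J ->
  (\int[P]_w (occ J k (fun j => X j w))%:R%:E)%E = (mocc q (size J) k)%:E.
Proof.
move=> k0 uJ aJ; rewrite -mocc_eseries //.
under eq_integral do rewrite occ_eseries //.
rewrite integral_nneseries //; last first.
  by move=> i; apply/measurable_EFinP; apply: measurable_indic; exact: measurable_E.
apply: eq_eseriesr => i _; rewrite integral_indic ?setIT //; last exact: measurable_E.
exact: hits_tail.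
Qed.

Lemma eseries_delta (i : nat) (c : R) : 0 <= c ->
  (\sum_(j <oo) ((j == i)%:R * c)%:E)%E = c%:E.
Proof.
move=> c0; rewrite (nneseriesD1 (n := i)) //; last by move=> j _; rewrite lee_fin mulr_ge0.
rewrite eqxx mul1r eseries0 ?adde0 // => j _ ji.
by rewrite (negbTE ji) mul0r.
Qed.

(** Pairs of equal urns contribute the mean, pairs of distinct ones at most its
    square. *)
Lemma integral_occ2 J k : (0 < k)%N -> uniq J -> all (ltn 0) J ->
  (\int[P]_w ((occ J k (fun j => X j w))%:R ^+ 2)%:E <=
   (mocc q (size J) k + mocc q (size J) k ^+ 2)%:E)%E.
Proof.
move=> k0 uJ aJ; set m := size J; set M := mocc q m k.
have q0 i : 0 <= q i by apply: urn_prob_ge0.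
have q1 i : 0 <= q i <= 1 by apply: q01 => // N; exact: urn_prob_sum.
have M0 : 0 <= M by apply: mocc_ge0 => //; exact: urn_prob_sum.
have mI i : measurable_fun setT (fun w => (\1_(E J k i) w)%:E : \bar R).
  by apply/measurable_EFinP; apply: measurable_indic; exact: measurable_E.
have mO : measurable_fun setT (fun w => (occ J k (fun j => X j w))%:R%:E : \bar R).
  by apply/measurable_EFinP; exact: measurable_occ.
have e w : (((occ J k (fun j => X j w))%:R ^+ 2)%:E =
    \sum_(i <oo) (occ J k (fun j => X j w))%:R%:E * (\1_(E J k i) w)%:E :> \bar R)%E.
  by rewrite nneseriesZl -?occ_eseries // -?EFinM ?expr2 // => i _; rewrite lee_fin.
under eq_integral do rewrite e.
rewrite integral_nneseries //; last by move=> i; apply: emeasurable_funM.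
have -> : (M + M ^+ 2)%:E = (\sum_(i <oo) (btail (q i) m k * (1 + M))%:E)%E.
  under eq_eseriesr do rewrite mulrC EFinM.
  rewrite nneseriesZl; last by move=> i _; rewrite lee_fin btail_ge0.
  by rewrite mocc_eseries // -EFinM -/M; congr (_%:E); ring.
apply: lee_nneseries.
  by move=> i _ _; apply: integral_ge0 => w _; rewrite -EFinM lee_fin mulr_ge0.
move=> i _.
have e2 w : ((occ J k (fun j => X j w))%:R%:E * (\1_(E J k i) w)%:E =
    \sum_(j <oo) (\1_(E J k i `&` E J k j) w)%:E :> \bar R)%E.
  rewrite muleC occ_eseries // -nneseriesZl //.
  by apply: eq_eseriesr => j _; rewrite indicI /= EFinM.
under eq_integral do rewrite e2.
rewrite integral_nneseries //; last first.
  move=> j; apply/measurable_EFinP; apply: measurable_indic.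
  by apply: measurableI; exact: measurable_E.
have -> : (btail (q i) m k * (1 + M))%:E =
  (\sum_(j <oo) (((j == i)%:R * btail (q i) m k)%:E
    + (btail (q i) m k * btail (q j) m k)%:E))%E.
  rewrite nneseriesD; last 2 first.
    by move=> j _ _; rewrite lee_fin mulr_ge0 // btail_ge0.
    by move=> j _ _; rewrite lee_fin mulr_ge0 // btail_ge0.
  rewrite eseries_delta ?btail_ge0 //.
  under [X in (_ + X)%E]eq_eseriesr do rewrite EFinM.
  rewrite nneseriesZl; last by move=> j _; rewrite lee_fin btail_ge0.
  by rewrite mocc_eseries // -EFinM -EFinD -/M; congr (_%:E); ring.
apply: lee_nneseries; first by move=> j _ _; apply: integral_ge0 => w _; rewrite lee_fin.
move=> j _; rewrite integral_indic ?setIT //; last by apply: measurableI; exact: measurable_E.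
case: (eqVneq j i) => [->|ji].
  rewrite setIid [X in (X <= _)%E](_ : _ = (btail (q i) m k)%:E); last exact: hits_tail.
  rewrite mul1r -EFinD lee_fin -/m lerDl mulr_ge0 ?btail_ge0 //.
rewrite mul0r add0e; apply: hits_pair_le => //; by rewrite eq_sym.
Qed.

(** Expanding the square would involve a subtraction of integrals; moving the
    cross term to the other side leaves nonnegative integrands only. *)
Lemma occ_variance J k : (0 < k)%N -> uniq J -> all (ltn 0) J ->
  let M := mocc q (size J) k in 0 < M ->
  (\int[P]_w (((occ J k (fun j => X j w))%:R / M - 1) ^+ 2)%:E <= M^-1%:E)%E.
Proof.
move=> k0 uJ aJ M M0.
have mO := measurable_occ J k0.
have mf : measurable_fun setT
    (fun w => (((occ J k (fun j => X j w))%:R / M - 1) ^+ 2)%:E : \bar R).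
  apply/measurable_EFinP; apply: measurable_funX; apply: measurable_funB => //.
  exact: measurable_funM.
have mg : measurable_fun setT
    (fun w => ((2 / M)%:E * (occ J k (fun j => X j w))%:R%:E : \bar R)%E).
  by apply: emeasurable_funM => //; apply/measurable_EFinP.
have h : ((\int[P]_w (((occ J k (fun j => X j w))%:R / M - 1) ^+ 2)%:E) + 2%:E =
  (M ^- 2)%:E * \int[P]_w ((occ J k (fun j => X j w))%:R ^+ 2)%:E + 1)%E.
  have -> : 2%:E = (\int[P]_w ((2 / M)%:E * (occ J k (fun j => X j w))%:R%:E))%E.
    rewrite ge0_integralZl_EFin //; [|exact/measurable_EFinP|by rewrite divr_ge0 // ltW].
    rewrite integral_occ // -EFinM -/M; congr (_%:E).
    by rewrite -mulrA mulVf ?mulr1 // gt_eqF.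
  rewrite -ge0_integralD //; last 2 first.
    by move=> w _; rewrite lee_fin sqr_ge0.
    by move=> w _; rewrite -EFinM lee_fin !mulr_ge0 // invr_ge0 ltW.
  have m2 : measurable_fun setT (fun w => ((occ J k (fun j => X j w))%:R ^+ 2)%:E : \bar R).
    by apply/measurable_EFinP; apply: measurable_funX.
  have f0 w : setT w -> (0 <= ((occ J k (fun j => X j w))%:R ^+ 2)%:E :> \bar R)%E.
    by move=> _; rewrite lee_fin sqr_ge0.
  have M2 : 0 <= M ^- 2 by rewrite invr_ge0 exprn_ge0 // ltW.
  rewrite -(ge0_integralZl_EFin P measurableT f0 m2 M2).
  rewrite [X in (_ = _ + X)%E](_ : _ = (\int[P]_w (cst 1%:E w))%E); last first.
    by have := expectation_cst P 1; rewrite unlock => ->.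
  rewrite -ge0_integralD //; last 2 first.
    by move=> w _; rewrite -EFinM lee_fin mulr_ge0 ?invr_ge0 ?sqr_ge0.
    by apply: emeasurable_funM.
  apply: eq_integral => w _; rewrite -!EFinM -!EFinD; congr (_%:E).
  by field; rewrite gt_eqF.
have h2 := integral_occ2 k0 uJ aJ; rewrite -/M in h2.
have : ((M ^- 2)%:E * \int[P]_w ((occ J k (fun j => X j w))%:R ^+ 2)%:E + 1
    <= (M^-1 + 2)%:E)%E.
  apply: (@le_trans _ _ ((M ^- 2)%:E * (M + M ^+ 2)%:E + 1)%E).
    by rewrite leeD2r // lee_wpmul2l // lee_fin invr_ge0 exprn_ge0 // ltW.
  rewrite -EFinM -EFinD lee_fin le_eqVlt; apply/orP; left; apply/eqP.
  by field; rewrite gt_eqF.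
by rewrite -h (EFinD M^-1 2) leeD2rE.
Qed.

End Moments.

(** * Counting balls in dilated unions of intervals *)

Section Balls.
Variable R : realType.
Implicit Types (A : set R) (n s t b : nat).

Definition seq_of (S : set nat) : seq nat := enum_fset (fset_set S).
Definition balls A n := seq_of (ball_indices A n).
(** The sets [n A] are not nested in [n]; this set and the next bracket all of
    them for [n] from [s] to [t]. *)
Definition inner_set A s t := [set b | forall n, (s <= n <= t)%N -> ball_indices A n b].
Definition outer_set A s t := [set b | exists2 n, (s <= n <= t)%N & ball_indices A n b].

Lemma mem_seq_of (S : set nat) b : finite_set S -> (b \in seq_of S) = (b \in S).
Proof. by move=> fS; exact: (in_fset_set fS b). Qed.

Lemma uniq_seq_of S : uniq (seq_of S).
Proof. exact: fset_uniq. Qed.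

Lemma ball_indicesE A n b : (0 < n)%N ->
  ball_indices A n b <-> (0 < b)%N /\ A (b%:R / n%:R).
Proof.
move=> n0; have n0' : n%:R != 0 :> R by rewrite pnatr_eq0 -lt0n.
split=> -[b0 h]; split => //.
  by case: h => a Aa /= <-; rewrite mulrC mulKf.
by exists (b%:R / n%:R) => //=; rewrite mulrC divfK.
Qed.

Lemma ball_indices_le A n b : A `<=` `[0, 1] -> ball_indices A n b -> (0 < b <= n)%N.
Proof.
move=> A01 [b0 [a /A01 /=]]; rewrite in_itv /= => /andP[a0 a1] e.
by rewrite b0 /= -(ler_nat R) -e ler_piMr.
Qed.

Lemma finite_set_of_bound (S : set nat) N : (forall b, S b -> (b <= N)%N) -> finite_set S.
Proof.
move=> H; apply: (@sub_finite_set _ _ `I_N.+1); last exact: finite_II.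
by move=> b /H /=; rewrite ltnS.
Qed.

Lemma finite_balls A n : A `<=` `[0, 1] -> finite_set (ball_indices A n).
Proof. by move=> A01; apply: (@finite_set_of_bound _ n) => b /(ball_indices_le A01)/andP[]. Qed.

Lemma finite_outer A s t : A `<=` `[0, 1] -> finite_set (outer_set A s t).
Proof.
move=> A01; apply: (@finite_set_of_bound _ t) => b [n /andP[_ nt]].
move=> /(ball_indices_le A01)/andP[_ h]; exact: leq_trans h nt.
Qed.

Lemma inner_sub A s t n : (s <= n <= t)%N -> inner_set A s t `<=` ball_indices A n.
Proof. by move=> h b; apply. Qed.

Lemma outer_sup A s t n : (s <= n <= t)%N -> ball_indices A n `<=` outer_set A s t.
Proof. by move=> h b Hb; exists n. Qed.

(** If [b / n] lies in the interval [I] and [b / n'] does not, one endpoint [e] of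
    [I] separates them; as both [n] and [n'] are between [s] and [t], the ball
    [b] is between [e s] and [e t].  The endpoints are [inf I] and [sup I]. *)
Lemma interval_escape (I : set R) : is_interval I -> I `<=` `[0, 1] ->
  exists es : seq R, size es = 2%N /\ (forall e, e \in es -> 0 <= e <= 1) /\
  forall s t n n' b, (0 < s)%N -> (s <= n <= t)%N -> (s <= n' <= t)%N ->
    I (b%:R / n%:R) -> ~ I (b%:R / n'%:R) ->
    exists2 e, e \in es & e * s%:R <= b%:R <= e * t%:R.
Proof.
move=> itvI I01; have [I0|/eqP/set0P[z Iz]] := pselect (I = set0).
  exists [:: 0; 0]; split => //; split; first by move=> e; rewrite !inE orbb => /eqP ->; lra.
  by move=> s t n n' b _ _ _; rewrite I0.
have lb : lbound I 0 by move=> x /I01 /=; rewrite in_itv /= => /andP[].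
have ub : ubound I 1 by move=> x /I01 /=; rewrite in_itv /= => /andP[].
have hl : has_lbound I by exists 0.
have hu : has_ubound I by exists 1.
have I0 : I !=set0 by exists z.
have i0 : 0 <= inf I by apply: lb_le_inf.
have s1 : sup I <= 1 by apply: ge_sup.
have iz : inf I <= z by apply: ge_inf.
have zs : z <= sup I by apply: ub_le_sup.
exists [:: inf I; sup I]; split => //; split.
  by move=> e; rewrite !inE => /orP[/eqP ->|/eqP ->]; lra.
move=> s t n n' b sp /andP[sn nt] /andP[sn' nt'] In nIn'.
have np : 0 < n%:R :> R by rewrite ltr0n; lia.
have np' : 0 < n'%:R :> R by rewrite ltr0n; lia.
have Lsn : s%:R <= n%:R :> R by rewrite ler_nat.
have Lsn' : s%:R <= n'%:R :> R by rewrite ler_nat.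
have Lnt : n%:R <= t%:R :> R by rewrite ler_nat.
have Lnt' : n'%:R <= t%:R :> R by rewrite ler_nat.
have h1 : inf I <= b%:R / n%:R by apply: ge_inf.
have h2 : b%:R / n%:R <= sup I by apply: ub_le_sup.
have b0 : 0 <= b%:R :> R by [].
have [nn'|n'n] := leqP n n'.
  have e1 : b%:R / n'%:R <= b%:R / n%:R :> R.
    by rewrite ler_wpM2l // lef_pV2 ?posrE // ler_nat.
  exists (inf I); first by rewrite !inE eqxx.
  have e2 : b%:R / n'%:R <= inf I.
    rewrite leNgt; apply/negP => h.
    have [y Iy yb] : exists2 y, I y & y < b%:R / n'%:R.
      apply: contrapT => H; move: h; apply/negP; rewrite -leNgt; apply: lb_le_inf => // y Iy.
      by rewrite leNgt; apply/negP => h'; apply: H; exists y.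
    apply: nIn'; apply: (itvI y (b%:R / n%:R)) => //.
    by rewrite (ltW yb).
  rewrite ler_pdivlMr // in h1; rewrite ler_pdivrMr // in e2.
  apply/andP; split; first by apply: le_trans h1; rewrite ler_wpM2l.
  by apply: le_trans e2 _; rewrite ler_wpM2l.
have e1 : b%:R / n%:R <= b%:R / n'%:R :> R.
  by rewrite ler_wpM2l // lef_pV2 ?posrE // ler_nat ltnW.
exists (sup I); first by rewrite !inE eqxx orbT.
have s0 : 0 <= sup I by lra.
have e2 : sup I <= b%:R / n'%:R.
  rewrite leNgt; apply/negP => h.
  have [y Iy yb] : exists2 y, I y & b%:R / n'%:R < y.
    apply: contrapT => H; move: h; apply/negP; rewrite -leNgt; apply: ge_sup => // y Iy.
    by rewrite leNgt; apply/negP => h'; apply: H; exists y.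
  apply: nIn'; apply: (itvI (b%:R / n%:R) y) => //.
  by rewrite (ltW yb) andbT.
rewrite ler_pdivrMr // in h2; rewrite ler_pdivlMr // in e2.
apply/andP; split; last by apply: le_trans h2 _; rewrite ler_wpM2l.
by apply: le_trans e2; rewrite ler_wpM2l.
Qed.

Lemma Bfin_escape A : Bfin A ->
  exists es : seq R, (forall e, e \in es -> 0 <= e <= 1) /\
  forall s t n n' b, (0 < s)%N -> (s <= n <= t)%N -> (s <= n' <= t)%N ->
    A (b%:R / n%:R) -> ~ A (b%:R / n'%:R) ->
    exists2 e, e \in es & e * s%:R <= b%:R <= e * t%:R.
Proof.
move=> [A01 [m [I eA]]].
have sub l : [set` I l] `<=` `[0, 1].
  by apply: subset_trans A01; rewrite eA => x Ix; exists l.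
have [f Hf] := choice (fun l => interval_escape (@interval_is_interval _ (I l)) (sub l)).
exists (flatten [seq f l | l <- enum 'I_m]); split.
  move=> e /flattenP[_ /mapP[l _ ->] el].
  by have [_ [h _]] := Hf l; exact: h.
move=> s t n n' b s0 hn hn'; rewrite eA => -[l _ Il] nI.
have [_ [_ H]] := Hf l.
have [|e ef he] := H s t n n' b s0 hn hn' Il; first by move=> h; apply: nI; exists l.
exists e => //; apply/flattenP; exists (f l) => //; apply: map_f.
by rewrite mem_enum.
Qed.

Lemma size_uniq_narrow (F : seq nat) h : uniq F ->
  (forall x y, x \in F -> y \in F -> (x <= y + h)%N) -> (size F <= h.+1)%N.
Proof.
move=> uF H; case: F uF H => [//|z F] uF H.
have ex : exists x, x \in z :: F by exists z; rewrite inE eqxx.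
case: (ex_minnP ex) => m mF mmin.
rewrite -(size_iota m h.+1); apply: uniq_leq_size => // x xF.
by rewrite mem_iota mmin //= addnS ltnS; apply: H.
Qed.

Lemma size_flatten_le (es : seq R) (W : R -> seq nat) h :
  (forall e, e \in es -> (size (W e) <= h)%N) ->
  (size (flatten [seq W e | e <- es]) <= size es * h)%N.
Proof.
elim: es => //= e es ih H; rewrite size_cat mulSn leq_add //.
  by apply: H; rewrite inE eqxx.
by apply: ih => e' h'; apply: H; rewrite inE h' orbT.
Qed.

(** A ball in the difference is between [e s] and [e t] for one of finitely many
    endpoints [e], all in [0, 1]; such a range holds at most [t - s + 1]
    integers. *)
Lemma outer_inner_size A : Bfin A -> exists K : nat, forall s t, (0 < s <= t)%N ->
  (size (seq_of (outer_set A s t)) <=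
   size (seq_of (inner_set A s t)) + K * (t - s).+1)%N.
Proof.
move=> hA; have A01 := hA.1.
have [es [es01 esc]] := Bfin_escape hA.
exists (size es) => s t /andP[s0 st].
pose W (e : R) := seq_of [set b : nat | e * s%:R <= b%:R <= e * t%:R].
have fW (e : R) : finite_set [set b : nat | e * s%:R <= b%:R <= e * t%:R].
  apply: (@finite_set_of_bound _ (Num.truncn (e * t%:R))) => b /andP[_ h].
  by rewrite truncn_ge_nat // (le_trans _ h).
have fI : finite_set (inner_set A s t).
  apply: sub_finite_set (finite_balls s A01); apply: inner_sub; lia.
have hW : (size (flatten [seq W e | e <- es]) <= size es * (t - s).+1)%N.
  apply: size_flatten_le => e /es01/andP[e0 e1].
  apply: size_uniq_narrow; first exact: uniq_seq_of.
  move=> x y; rewrite !mem_seq_of // !inE => /andP[_ h1] /andP[h2 _].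
  rewrite -(ler_nat R) natrD natrB //.
  have : s%:R <= t%:R :> R by rewrite ler_nat.
  by nra.
apply: leq_trans (leq_add (leqnn _) hW); rewrite -size_cat.
apply: uniq_leq_size; first exact: uniq_seq_of.
move=> b; rewrite mem_cat !mem_seq_of //; last exact: finite_outer.
rewrite !inE => -[n hn Ab]; case: (pselect (inner_set A s t b)) => [h|nh].
  by apply/orP; left; apply/mem_set.
apply/orP; right.
have np : (0 < n)%N by lia.
have [b0 Abn] := (ball_indicesE A b np).1 Ab.
have [n' hn' nA] : exists2 n', (s <= n' <= t)%N & ~ ball_indices A n' b.
  apply: contrapT => H; apply: nh => n' hn'; apply: contrapT => H'; apply: H.
  by exists n'.
have np' : (0 < n')%N by lia.
have [|e ees he] := esc s t n n' b s0 hn hn' Abn.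
  by move=> h; apply: nA; apply/(ball_indicesE A b np').
apply/flattenP; exists (W e); first exact: map_f.
by rewrite mem_seq_of // inE.
Qed.

(** If none of the intervals had two points, [A] would be finite. *)
Lemma Bfin_itv A : Bfin A -> (0 < lebesgue_measure A)%E ->
  exists a b : R, a < b /\ `[a, b] `<=` A.
Proof.
move=> [A01 [m [I eA]]] A0; apply: contrapT => H.
suff : countable A by move/countable_lebesgue_measure0 => h; rewrite h ltxx in A0.
apply: finite_set_countable; rewrite eA.
apply: bigcup_finite => [|l _]; first exact: finite_finset.
have [->|/eqP/set0P[x Ix]] := pselect ([set` I l] = set0); first exact: finite_set0.
apply: (@sub_finite_set _ _ [set x]); last exact: finite_set1.
move=> y Iy; apply: contrapT => yx; apply: H.
have itvI := @interval_is_interval _ (I l).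
have sub : [set` I l] `<=` A by rewrite eA => z Iz; exists l.
have [xy|yx'|e] := ltgtP x y; last by case: yx.
  exists x, y; split => // z; rewrite /= in_itv /= => hz; apply: sub.
  exact: (itvI x y).
exists y, x; split => // z; rewrite /= in_itv /= => hz; apply: sub.
exact: (itvI y x).
Qed.

(** With [a, b] an interval inside [A], the integers from [n a] to [n b] are at
    least [n (b - a) - 1] in number. *)
Lemma balls_size_ge A : Bfin A -> (0 < lebesgue_measure A)%E ->
  exists2 delta : R, 0 < delta & forall n, (0 < n)%N ->
    delta * n%:R - 1 <= (size (balls A n))%:R.
Proof.
move=> hA A0; have A01 := hA.1; have [a [b [ab sub]]] := Bfin_itv hA A0.
have a0 : 0 <= a.
  have /sub/A01 /= : [set` `[a, b]] a by rewrite /= in_itv /= lexx ltW.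
  by rewrite in_itv /= => /andP[].
exists (b - a); rewrite ?subr_gt0 // => n n0.
have np : 0 < n%:R :> R by rewrite ltr0n.
have na0 : 0 <= a * n%:R by rewrite mulr_ge0.
have nb0 : 0 <= b * n%:R by rewrite mulr_ge0 // ltW // (le_lt_trans a0).
set f := Num.truncn (a * n%:R); set g := Num.truncn (b * n%:R).
have hf := truncn_itv na0; have hg := truncn_itv nb0; rewrite -/f -/g in hf hg.
have fg : (f <= g)%N by apply: le_truncn; rewrite ler_wpM2r // ltW.
apply: (@le_trans _ _ (g - f)%:R).
  by rewrite natrB //; move: hf hg; rewrite -!natr1 => /andP[? ?] /andP[? ?]; nra.
rewrite ler_nat -(size_iota f.+1 (g - f)); apply: uniq_leq_size; first exact: iota_uniq.
move=> j; rewrite mem_iota addSn subnKC // ltnS => /andP[fj jg].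
rewrite mem_seq_of; last exact: finite_balls.
apply/mem_set/ball_indicesE => //; split; first by lia.
apply: sub; rewrite /= in_itv /= ler_pdivlMr // ler_pdivrMr //.
move: hf hg => /andP[_ h1] /andP[h2 _]; apply/andP; split.
  by apply: le_trans (ltW h1) _; rewrite ler_nat.
by apply: le_trans h2; rewrite ler_nat.
Qed.

End Balls.

(** * From summable second moments to almost sure convergence *)

Lemma cvg_series_inv_sq (R : realType) :
  cvgn (series (fun i => (i.+1%:R ^+ 2)^-1 : R)).
Proof.
apply: nondecreasing_is_cvgn.
  by apply: nondecreasing_series => i _ _; rewrite invr_ge0 exprn_ge0.
exists 2 => _ [N _ <-]; rewrite /series /=.
(* 1 / (N + 1)^2 <= 1 / N - 1 / (N + 1); at N = 0 the inverse of 0 is 0. *)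
suff : \sum_(0 <= i < N) (i.+1%:R ^+ 2)^-1 <= 2 - N%:R^-1 :> R.
  by move/le_trans; apply; rewrite gerBl invr_ge0.
elim: N => [|[|N] ih]; first by rewrite big_geq // invr0 subr0.
  by rewrite big_nat1 expr1n; lra.
rewrite big_nat_recr //=; apply: le_trans (lerD ih (lexx _)) _.
set x : R := N.+1%:R; rewrite -[N.+2%:R]natr1 -/x.
have x0 : 0 < x by rewrite ltr0n.
have y0 : 0 < x + 1 by rewrite addr_gt0.
rewrite -subr_ge0.
have -> : 2 - (x + 1)^-1 - (2 - x^-1 + ((x + 1) ^+ 2)^-1) = (x * (x + 1) ^+ 2)^-1.
  by field; rewrite !gt_eqF.
by rewrite invr_ge0 mulr_ge0 ?exprn_ge0 // ltW.
Qed.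

(** [Num.min 1 c] is at most 1, so its [C]-th power is still at most [c]. *)
Lemma root_growth (R : realType) (C : nat) (c M x : R) : (0 < C)%N -> 0 < c ->
  0 <= M -> 0 <= x -> c * x ^+ C <= M ^+ C -> Num.min 1 c * x <= M.
Proof.
move=> C0 c0 M0 x0 h; set e := Num.min 1 c.
have e0 : 0 < e by rewrite lt_min ltr01.
have e1 : e <= 1 by rewrite ge_min lexx.
have ec : e <= c by rewrite ge_min lexx orbT.
have eC : e ^+ C <= e by rewrite -[leRHS]expr1; apply: ler_wiXn2l => //; exact: ltW.
rewrite -(@ler_pXn2r _ C) ?nnegrE ?mulr_ge0 ?(ltW e0) //.
rewrite exprMn; apply: le_trans h; apply: ler_wpM2r; first exact: exprn_ge0.
exact: le_trans eC ec.
Qed.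

Section AlmostSure.
Context d (T : measurableType d) (R : realType) (P : probability T R).

(** The series of the [f j] has a finite mean, so it converges almost surely, and
    the terms of a convergent series tend to 0. *)
Lemma ae_cvg0_of_summable (f : nat -> T -> R) (b : nat -> R) :
  (forall j, measurable_fun setT (f j)) -> (forall j w, 0 <= f j w) ->
  (forall j, (\int[P]_w (f j w)%:E <= (b j)%:E)%E) -> cvgn (series b) ->
  {ae P, forall w, f j w @[j --> \oo] --> (0 : R)}.
Proof.
move=> mf f0 fb cb.
pose g w := (\sum_(j <oo) (f j w)%:E)%E.
have mg : measurable_fun setT g.
  apply: (ge0_emeasurable_sum (P := xpredT)); first by move=> i w _ _; rewrite lee_fin.
  by move=> i _; apply/measurable_EFinP.
have g0 w : (0 <= g w)%E by apply: nneseries_ge0 => i _ _; rewrite lee_fin.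
have b0 j : 0 <= b j.
  by rewrite -lee_fin; apply: le_trans (fb j); apply: integral_ge0 => w _; rewrite lee_fin.
have ig : P.-integrable setT g.
  apply/integrableP; split => //.
  under eq_integral do rewrite gee0_abs //.
  rewrite integral_nneseries //; last 2 first.
    by move=> j; apply/measurable_EFinP.
    by move=> j w _; rewrite lee_fin.
  apply: (@le_lt_trans _ _ (\sum_(j <oo) (b j)%:E)%E).
    apply: lee_nneseries => // j _ _.
    by apply: integral_ge0 => w _; rewrite lee_fin.
  have -> : (\sum_(j <oo) (b j)%:E)%E = (limn (series b))%:E.
    by rewrite -EFin_lim //; congr (limn _); apply/funext => N /=; rewrite sumEFin.
  exact: ltry.
apply: filterS (integrable_ae measurableT ig) => w /(_ Logic.I) gw.
apply: cvg_series_cvg_0; apply: nnseries_is_cvg => //.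
by rewrite ltey_eq gw.
Qed.

Lemma cvg1_of_sqr_cvg0 (u : nat -> R) : (u j - 1) ^+ 2 @[j --> \oo] --> (0 : R) ->
  u j @[j --> \oo] --> (1 : R).
Proof.
move=> h; apply/cvgrPdist_le => e e0.
have e2 : 0 < e ^+ 2 by rewrite exprn_gt0.
move/cvgrPdist_le : h => /(_ _ e2); apply: filterS => j.
rewrite sub0r normrN ger0_norm ?sqr_ge0 // distrC -[X in X <= _]real_normK ?num_real //.
by rewrite ler_pXn2r ?nnegrE // ltW.
Qed.

End AlmostSure.

(** * Blocks of sample sizes between consecutive mesh points *)

Section Blocks.
Variables (R : realType) (A : set R) (C : nat).
Hypotheses (hA : Bfin A) (hA0 : (0 < lebesgue_measure A)%E) (C0 : (0 < C)%N).

(** A polynomial mesh is dense enough for consecutive points to have a ratio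
    tending to 1, and sparse enough for the inverse mean occupancies along it to
    be summable once [C] is large. *)
Definition mesh j : nat := (j.+1 ^ C)%N.
Definition inner_block j := seq_of (inner_set A (mesh j) (mesh j.+1)).
Definition outer_block j := seq_of (outer_set A (mesh j) (mesh j.+1)).

Lemma mesh_gt0 j : (0 < mesh j)%N. Proof. by rewrite expn_gt0. Qed.

Lemma mesh_le j : (mesh j <= mesh j.+1)%N.
Proof. by rewrite leq_exp2r. Qed.

Lemma mesh_ge j : (j.+1 <= mesh j)%N.
Proof. by rewrite /mesh -{1}(expn1 j.+1) leq_pexp2l. Qed.

Lemma mesh_cover n : exists j, (mesh j <= n.+1 < mesh j.+1)%N.
Proof.
elim: n => [|n [j /andP[h1 h2]]].
  by exists 0%N; have := ltn_exp2r 1 2 C0; rewrite /mesh exp1n => ->.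
case: (ltnP n.+2 (mesh j.+1)) => h; first by exists j; rewrite h (leq_trans h1).
exists j.+1; rewrite h /=; apply: leq_ltn_trans h2 _.
by rewrite ltn_exp2r.
Qed.

Lemma mesh_gap_cvg0 :
  (mesh j.+1 - mesh j).+1%:R / (mesh j)%:R @[j --> \oo] --> (0 : R).
Proof.
(* Everything is a polynomial in h = 1 / (j + 1), since the ratio of the two
   mesh points is (1 + h) ^ C. *)
have e j : (mesh j.+1 - mesh j).+1%:R / (mesh j)%:R =
    (1 + harmonic j) ^+ C - 1 + harmonic j ^+ C :> R.
  rewrite -natr1 natrB ?mesh_le // /mesh !natrX /=.
  have x0 : j.+1%:R != 0 :> R by rewrite pnatr_eq0.
  rewrite !mulrDl mulNr divff ?expf_neq0 // -expr_div_n mul1r exprVn.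
  congr (_ ^+ C - 1 + _); rewrite -(natr1 j.+1) mulrDl divff // mul1r //.
under eq_fun do rewrite e.
have hh : harmonic j @[j --> \oo] --> (0 : R) := cvg_harmonic.
have cX (u : nat -> R) (l : R) : u j @[j --> \oo] --> l -> u j ^+ C @[j --> \oo] --> l ^+ C.
  move=> h; apply: (cvg_comp u (fun x : R => x ^+ C) h); exact: exprn_continuous.
have -> : (0 : R) = (1 + 0) ^+ C - 1 + 0 ^+ C.
  by rewrite addr0 expr1n subrr add0r expr0n; case: C C0.
apply: cvgD; last first.
  exact: cX.
apply: cvgB; last exact: cvg_cst.
have h1 : 1 + harmonic j @[j --> \oo] --> (1 + 0 : R).
  by apply: cvgD; [exact: cvg_cst|].
exact: cX.
Qed.

Lemma inner_block_sub_outer j : {subset inner_block j <= outer_block j}.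
Proof.
have A01 := hA.1.
have hj : (mesh j <= mesh j <= mesh j.+1)%N by rewrite leqnn mesh_le.
move=> b; rewrite !mem_seq_of; last 2 first.
- exact: finite_outer.
- by apply: sub_finite_set (finite_balls (mesh j) A01); exact: inner_sub.
by rewrite !inE => /(inner_sub hj); exact: outer_sup.
Qed.

Lemma inner_block_sub_balls j n : (mesh j <= n <= mesh j.+1)%N ->
  {subset inner_block j <= balls A n}.
Proof.
move=> hn; have A01 := hA.1.
move=> b; rewrite !mem_seq_of; last 2 first.
- exact: finite_balls.
- by apply: sub_finite_set (finite_balls n A01); exact: inner_sub.
by rewrite !inE => /(inner_sub hn).
Qed.

Lemma balls_sub_outer_block j n : (mesh j <= n <= mesh j.+1)%N ->
  {subset balls A n <= outer_block j}.
Proof.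
move=> hn; have A01 := hA.1.
move=> b; rewrite !mem_seq_of; last 2 first.
- exact: finite_outer.
- exact: finite_balls.
by rewrite !inE => /(outer_sup hn).
Qed.

(** The outer block contains [n A] for [n] the mesh point, hence at least a
    constant times [mesh j] balls; the difference of the two blocks is negligible
    with respect to [mesh j], so the same holds for the inner block. *)
Lemma blocks_size : exists2 delta : R, 0 < delta &
  (\forall j \near \oo, delta * (mesh j)%:R <= (size (inner_block j))%:R) /\
  ((size (outer_block j) - size (inner_block j))%:R / (size (inner_block j))%:R
    @[j --> \oo] --> (0 : R)).
Proof.
have [delta d0 hd] := balls_size_ge hA hA0.
have [K hK] := outer_inner_size hA.
pose w j : R := (mesh j.+1 - mesh j).+1%:R / (mesh j)%:R.
have w0 : w j @[j --> \oo] --> (0 : R) := mesh_gap_cvg0.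
have mp j : 0 < (mesh j)%:R :> R by rewrite ltr0n mesh_gt0.
have gap j : (size (outer_block j))%:R <=
    (size (inner_block j))%:R + K%:R * (w j * (mesh j)%:R).
  rewrite /w divfK ?gt_eqF // -natrM -natrD ler_nat; apply: hK.
  by rewrite mesh_gt0 mesh_le.
have lo j : (mesh j)%:R * (delta - (K%:R + 1) * w j) <= (size (inner_block j))%:R.
  have hj : (mesh j <= mesh j <= mesh j.+1)%N by rewrite leqnn mesh_le.
  have h1 := hd _ (mesh_gt0 j).
  have h2 : (size (balls A (mesh j)))%:R <= (size (outer_block j))%:R :> R.
    by rewrite ler_nat; apply: uniq_leq_size; [exact: uniq_seq_of|exact: balls_sub_outer_block].
  have h3 := gap j.
  have h4 : 1 <= w j * (mesh j)%:R by rewrite /w divfK ?gt_eqF // ler1n.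
  by nra.
have d2 : 0 < delta / 2 by rewrite divr_gt0.
have low : \forall j \near \oo, delta / 2 * (mesh j)%:R <= (size (inner_block j))%:R.
  have : (K%:R + 1) * w j @[j --> \oo] --> (0 : R).
    by rewrite -(mulr0 (K%:R + 1)); apply: cvgMl_tmp.
  move/cvgrPdist_le => /(_ _ d2); apply: filterS => j.
  rewrite sub0r normrN => /(le_trans (ler_norm _)) h.
  by apply: le_trans (lo j); rewrite mulrC; apply: ler_wpM2l; [exact: ltW|lra].
exists (delta / 2) => //; split => //.
apply: (@squeeze_cvgr _ _ _ _ (fun=> 0) (fun j => K%:R / (delta / 2) * w j)).
- near=> j.
  have h : delta / 2 * (mesh j)%:R <= (size (inner_block j))%:R by near: j.
  have Dp : 0 < (size (inner_block j))%:R :> R by apply: lt_le_trans h; rewrite mulr_gt0.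
  rewrite divr_ge0 //= ler_pdivrMr // natrB; last first.
    by apply: uniq_leq_size; [exact: uniq_seq_of|exact: inner_block_sub_outer].
  rewrite lerBlDl; apply: le_trans (gap j) _; rewrite lerD2l.
  have wp : 0 <= w j by rewrite divr_ge0.
  have kp : 0 <= K%:R / (delta / 2) * w j by rewrite mulr_ge0 // divr_ge0 // ltW.
  apply: le_trans (ler_wpM2l kp h).
  rewrite le_eqVlt; apply/orP; left; apply/eqP.
  by field; rewrite gt_eqF.
- exact: cvg_cst.
- by rewrite -(mulr0 (K%:R / (delta / 2))); apply: cvgMl_tmp.
Unshelve. all: by end_near.
Qed.

End Blocks.

(** * Law of large numbers for the occupancy count *)

Section OccupancyLLN.
Context d (T : measurableType d) (R : realType) (P : probability T R).
Variables (X : nat -> {RV P >-> nat}) (hX : iid_labels X).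

Let q i : R := urn_prob X i.+1.
Let q_ge0 i : 0 <= q i. Proof. exact: urn_prob_ge0. Qed.
Let q_sum N : \sum_(0 <= i < N) q i <= 1. Proof. exact: urn_prob_sum. Qed.
Let occX J k w : R := (occ J k (fun j => X j w))%:R.
Let M m k := mocc q m k.

(** The relative variances are at most [c^-1 / j.+1 ^ 2], which is summable. *)
Lemma occ_ratio_ae (k : nat) (J : nat -> seq nat) (c : R) : (0 < k)%N -> 0 < c ->
  (forall j, uniq (J j)) -> (forall j, all (ltn 0) (J j)) ->
  (\forall j \near \oo, c * j.+1%:R ^+ 2 <= M (size (J j)) k) ->
  {ae P, forall w, occX (J j) k w / M (size (J j)) k @[j --> \oo] --> (1 : R)}.
Proof.
move=> k0 c0 uJ aJ [j0 _ Hj].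
have Hb j : c * j.+1%:R ^+ 2 <= M (size (J (j + j0)%N)) k.
  apply: le_trans (Hj _ (leq_addl j j0)).
  by apply: ler_wpM2l; rewrite ?(ltW c0) // ler_pXn2r ?nnegrE // ler_nat; lia.
have cp j : 0 < c * j.+1%:R ^+ 2 by rewrite mulr_gt0 // exprn_gt0 // ltr0n.
have Mp j : 0 < M (size (J (j + j0)%N)) k by apply: lt_le_trans (Hb j).
have ae := @ae_cvg0_of_summable _ _ _ P
  (fun j w => (occX (J (j + j0)%N) k w / M (size (J (j + j0)%N)) k - 1) ^+ 2)
  (fun j => c^-1 * (j.+1%:R ^+ 2)^-1).
apply: filterS (ae _ _ _ _).
- by move=> w /cvg1_of_sqr_cvg0 h; rewrite -(cvg_shiftn j0).
- move=> j; apply: measurable_funX; apply: measurable_funB => //; apply: measurable_funM => //.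
  exact: measurable_occ.
- by move=> j w; rewrite sqr_ge0.
- move=> j; apply: le_trans (occ_variance hX k0 (uJ _) (aJ _) (Mp j)) _.
  by rewrite lee_fin -invfM lef_pV2 ?posrE.
- have h := @cvg_series_inv_sq R.
  have -> : series (fun j => c^-1 * (j.+1%:R ^+ 2)^-1) =
      (fun N => c^-1 * series (fun j => (j.+1%:R ^+ 2)^-1) N).
    by apply/funext => N; rewrite /series /= -mulr_sumr.
  by apply: is_cvgMl_tmp.
Qed.

(** Counts and means are monotone in the set of balls, and [mocc_thinning_iter]
    bounds the mean for [D] from below by [1 - delta] times the mean for [U]. *)
Lemma occ_sandwich k (D B U : seq nat) w
    (delta := k%:R * (size U - size D)%:R / (size D)%:R : R) :
  (0 < k)%N -> uniq D -> uniq B -> uniq U -> {subset D <= B} -> {subset B <= U} ->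
  (k <= size D)%N -> 0 < M (size D) k -> delta < 1 ->
  (1 - delta) * (occX D k w / M (size D) k) <= occX B k w / M (size B) k
    <= (occX U k w / M (size U) k) / (1 - delta).
Proof.
move=> k0 uD uB uU DB BU kD MD d1.
have sDB : (size D <= size B)%N by apply: uniq_leq_size.
have sBU : (size B <= size U)%N by apply: uniq_leq_size.
have m1 : M (size D) k <= M (size B) k by apply: mocc_homo.
have m2 : M (size B) k <= M (size U) k by apply: mocc_homo.
have m3 : (1 - delta) * M (size U) k <= M (size D) k.
  by apply: mocc_thinning_iter => //; [rewrite k0|exact: leq_trans sBU].
have o1 : occX D k w <= occX B k w by rewrite ler_nat; apply: occ_subset.
have o2 : occX B k w <= occX U k w by rewrite ler_nat; apply: occ_subset.
have p0 : 0 <= occX D k w by [].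
have MB : 0 < M (size B) k by apply: lt_le_trans m1.
have MU : 0 < M (size U) k by apply: lt_le_trans m2.
have e1 : 0 < 1 - delta by rewrite subr_gt0.
have aMB : (1 - delta) * M (size B) k <= M (size D) k.
  by apply: le_trans m3; apply: ler_wpM2l => //; exact: ltW.
apply/andP; split.
  rewrite ler_pdivlMr // mulrAC.
  have h : 0 <= occX D k w / M (size D) k by rewrite divr_ge0 // ltW.
  apply: le_trans (ler_wpM2r h aMB) _.
  by rewrite mulrC divfK ?gt_eqF.
rewrite ler_pdivlMr // ler_pdivlMr // -mulrA.
have h : 0 <= occX B k w / M (size B) k by rewrite divr_ge0 // ltW.
apply: le_trans (ler_wpM2l h (le_trans m3 m1)) _.
by rewrite divfK ?gt_eqF.
Qed.

Lemma seq_of_gt0 (S : set nat) : finite_set S -> (forall b, S b -> (0 < b)%N) ->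
  all (ltn 0) (seq_of S).
Proof. by move=> fS H; apply/allP => b; rewrite mem_seq_of // inE => /H. Qed.

(** The hypothesis on [M n k ^+ C] is what makes [C] a suitable exponent for the
    mesh: a block then has mean occupancy at least of order [j.+1 ^ 2]. *)
Lemma occ_balls_lln (A : set R) (k C n1 : nat) (c : R) :
  Bfin A -> (0 < lebesgue_measure A)%E -> (0 < k)%N -> (0 < C)%N -> 0 < c ->
  (forall n, (n1 <= n)%N -> c * n%:R ^+ 2 <= M n k ^+ C) ->
  {ae P, forall w, occX (balls A n) k w / M (size (balls A n)) k @[n --> \oo] --> (1 : R)}.
Proof.
move=> hA hA0 k0 C0 c0 hM; have A01 := hA.1.
have [delta d0 [lowD gapD]] := blocks_size hA hA0 C0.
set D := inner_block A C in lowD gapD *; set U := outer_block A C in gapD *.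
have bpos n b : ball_indices A n b -> (0 < b)%N by case.
have hj j : (mesh C j <= mesh C j <= mesh C j.+1)%N by rewrite leqnn mesh_le.
have aD j : all (ltn 0) (D j).
  apply: seq_of_gt0.
    by apply: sub_finite_set (finite_balls (mesh C j) A01); exact: inner_sub.
  by move=> b /(inner_sub (hj j)) /bpos.
have aU j : all (ltn 0) (U j).
  by apply: seq_of_gt0; [exact: finite_outer|move=> b [n _] /bpos].
have uD j : uniq (D j) by exact: uniq_seq_of.
have uU j : uniq (U j) by exact: uniq_seq_of.
have DU j : {subset D j <= U j} by exact: inner_block_sub_outer.
pose e := Num.min 1 (c * delta ^+ 2).
have e0 : 0 < e by rewrite lt_min ltr01 mulr_gt0 // exprn_gt0.
have bigD : \forall j \near \oo, (n1 + k < size (D j))%N.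
  have h0 : 0 <= (n1 + k)%:R / delta by rewrite divr_ge0 // ltW.
  have hb := archi_boundP h0; near=> j.
  have h1 : delta * (mesh C j)%:R <= (size (D j))%:R by near: j.
  have h2 : (Num.bound ((n1 + k)%:R / delta) <= j)%N.
    by near: j; exists (Num.bound ((n1 + k)%:R / delta)).
  rewrite -(ltr_nat R); apply: lt_le_trans h1.
  rewrite mulrC -ltr_pdivrMr //; apply: lt_le_trans hb _; rewrite ler_nat.
  by apply: leq_trans h2 _; apply: ltnW; apply: mesh_ge.
have growD : \forall j \near \oo, e * j.+1%:R ^+ 2 <= M (size (D j)) k.
  near=> j.
  have h1 : delta * (mesh C j)%:R <= (size (D j))%:R by near: j.
  have h2 : (n1 + k < size (D j))%N by near: j.
  apply: (root_growth (C := C)) => //.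
  - by rewrite mulr_gt0 // exprn_gt0.
  - exact: mocc_ge0.
  - have /hM h3 : (n1 <= size (D j))%N by lia.
    apply: le_trans h3; rewrite -mulrA; apply: ler_wpM2l; first exact: ltW.
    rewrite -exprM mulnC exprM -exprMn ler_pXn2r ?nnegrE ?mulr_ge0 ?exprn_ge0 ?(ltW d0) //.
    by rewrite -natrX.
have growU : \forall j \near \oo, e * j.+1%:R ^+ 2 <= M (size (U j)) k.
  apply: filterS growD => j /le_trans; apply; apply: mocc_homo => //.
  by apply: uniq_leq_size.
(* jn n is the block of n.+1; the shift by one leaves out n = 0, which is in no
   block. *)
have [jn Hjn] := choice (mesh_cover C0).
have jnoo : jn n @[n --> \oo] --> \oo.
  apply/cvgnyPge => N; exists (mesh C N) => // n /= hn.
  have /andP[_ h] := Hjn n.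
  have : (mesh C N < mesh C (jn n).+1)%N by lia.
  by rewrite /mesh ltn_exp2r.
pose dl j : R := k%:R * (size (U j) - size (D j))%:R / (size (D j))%:R.
have dl0 : dl j @[j --> \oo] --> (0 : R).
  under eq_fun do rewrite /dl -mulrA.
  by rewrite -(mulr0 k%:R); apply: cvgMl_tmp.
have dl1 : 1 - dl j @[j --> \oo] --> (1 : R).
  by rewrite -[X in _ --> X]subr0; apply: cvgB => //; exact: cvg_cst.
apply: filterS2 (occ_ratio_ae k0 e0 uD aD growD) (occ_ratio_ae k0 e0 uU aU growU).
move=> w hD hU; rewrite -cvg_shiftS.
have lo : (1 - dl j) * (occX (D j) k w / M (size (D j)) k) @[j --> \oo] --> (1 : R).
  by rewrite -[X in _ --> X]mulr1; apply: cvgM.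
have up : (occX (U j) k w / M (size (U j)) k) / (1 - dl j) @[j --> \oo] --> (1 : R).
  rewrite -[X in _ --> X](divr1 (1 : R)); apply: cvgM => //.
  by apply: cvgV => //; exact: oner_neq0.
apply: (squeeze_cvgr _ (cvg_comp _ _ jnoo lo) (cvg_comp _ _ jnoo up)).
pose ok j := [/\ (n1 + k < size (D j))%N, e * j.+1%:R ^+ 2 <= M (size (D j)) k & dl j < 1].
have good : \forall j \near \oo, ok j.
  have h1 : \forall j \near \oo, dl j < 1.
    move/cvgrPdist_lt : dl0 => /(_ 1 ltr01); apply: filterS => j.
    by rewrite sub0r normrN; exact/le_lt_trans/ler_norm.
  by near=> j; split; near: j.
have G : \forall n \near \oo, ok (jn n) := jnoo _ good.
apply: filterS G => n [g1 g2 g3] /=.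
have hn : (mesh C (jn n) <= n.+1 <= mesh C (jn n).+1)%N by have := Hjn n; lia.
apply: occ_sandwich => //.
- exact: uniq_seq_of.
- exact: inner_block_sub_balls.
- exact: balls_sub_outer_block.
- by lia.
- by apply: lt_le_trans g2; rewrite mulr_gt0 // exprn_gt0.
Unshelve. all: by end_near.
Qed.

End OccupancyLLN.

(** * Regular variation gives doubling *)

Section Alpha.
Variables (R : realType) (p : nat -> R).
Hypothesis p_sum : forall N, \sum_(0 <= i < N) p i.+1 <= 1.
Hypothesis p_mon : forall i, (0 < i)%N -> p i.+1 <= p i.

Lemma p_nonincreasing i j : (0 < i)%N -> (i <= j)%N -> p j <= p i.
Proof.
move=> i0; elim: j => [|j ih]; first by rewrite leqn0 => /eqP e; rewrite e in i0.
rewrite leq_eqVlt ltnS => /predU1P[->//|ij].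
by apply: le_trans (ih ij); apply: p_mon; apply: leq_trans ij.
Qed.

(** If [p i >= 1 / x], so are the [i] first probabilities, and they sum to at
    most 1; hence [i <= x]. *)
Lemma finite_alpha x : 0 < x -> finite_set [set i : nat | (0 < i)%N /\ x^-1 <= p i].
Proof.
move=> x0; apply: (@finite_set_of_bound _ (Num.truncn x)) => i [i0 h].
rewrite truncn_ge_nat; last exact: ltW.
rewrite -[leRHS]mulr1 -ler_pdivrMl //; apply: le_trans (p_sum i).
rewrite mulrC -[i in leLHS]subn0 -sumr_const_nat mulr_suml big_nat [leRHS]big_nat.
apply: ler_sum => l /andP[_ li]; rewrite mul1r; apply: le_trans h _.
exact: p_nonincreasing.
Qed.

(** The urns of probability at least [1 / x] form an initial segment, of which
    [alpha] is the last label, that is, the length. *)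
Lemma alphaP x i : 0 < x -> (i < alpha p x)%N = (1 <= x * p i.+1).
Proof.
move=> x0; have fS := finite_alpha x0; rewrite -ler_pdivrMl // mulr1.
apply/idP/idP => h.
  rewrite leNgt; apply/negP => h'.
  suff : (alpha p x <= i)%N by rewrite leqNgt h.
  apply/bigmax_leqP_seq => j; rewrite in_fset_set // inE => -[j0 hj] _.
  rewrite leqNgt; apply/negP => ij.
  by have := le_lt_trans (le_trans hj (p_nonincreasing (ltn0Sn i) ij)) h'; rewrite ltxx.
rewrite /alpha (big_rem i.+1) /=; first exact: leq_maxl.
by rewrite in_fset_set // inE.
Qed.

Variables (theta : R) (L : R -> R).
Hypothesis htheta0 : 0 < theta.
Hypothesis hL : slowly_varying L.
Hypothesis halpha : forall x : R, 0 < x -> (alpha p x)%:R = x `^ theta * L x.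
Hypothesis p1_gt0 : 0 < p 1.

(** The ratio [alpha (2 n) / alpha n] tends to [2 `^ theta > 1]; any [rho] strictly
    between 1 and this limit works, and the proof takes the midpoint. *)
Lemma alpha_doubling : exists rho : R, exists n0 : nat, [/\ 1 < rho, (0 < n0)%N,
  (0 < alpha p n0%:R)%N &
  forall n, (n0 <= n)%N -> rho * (alpha p n%:R)%:R <= (alpha p (2 * n)%:R)%:R].
Proof.
have [[x0 [_ Lpos]] /(_ 2 (ltr0n _ 2)) L2] := hL.
set z : R := 2 `^ theta.
have z1 : 1 < z.
  by rewrite /z /powR pnatr_eq0 /= -[ltLHS]expR0 ltr_expR mulr_gt0 // ln_gt0 // ltr1n.
pose rho := (1 + z) / 2.
have r1 : 1 < rho by rewrite /rho; lra.
have rz : rho / z < 1 by rewrite ltr_pdivrMr ?mul1r /rho; lra.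
have [M [_ HM]] : \forall x \near +oo, rho / z <= L (2 * x) / L x.
  by apply: (cvgr_ge (1 : R)) => //; exact: L2.
exists rho; exists (maxn 1 (maxn (Num.bound `|M|)
  (maxn (Num.bound `|x0|) (Num.bound (p 1)^-1)))).
have bnd (y : R) n : (Num.bound `|y| <= n)%N -> y < n%:R.
  move=> h; apply: le_lt_trans (ler_norm y) _.
  by apply: lt_le_trans (archi_boundP (normr_ge0 y)) _; rewrite ler_nat.
split => //; first by rewrite leq_max ltnSn.
  rewrite alphaP; last by rewrite ltr0n leq_max ltnSn.
  rewrite -ler_pdivrMr // mul1r.
  have h : 0 <= (p 1)^-1 by rewrite invr_ge0 ltW.
  by apply: le_trans (ltW (archi_boundP h)) _; rewrite ler_nat !leq_max leqnn !orbT.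
move=> n; rewrite !geq_max => /and4P[n1 /bnd hM /bnd hx0 _].
have np : 0 < n%:R :> R by rewrite ltr0n.
have Ln : 0 < L n%:R by apply: Lpos; exact: ltW.
have := HM _ hM; rewrite ler_pdivlMr // -natrM => h.
rewrite !halpha ?natrM ?mulr_gt0 // powRM // -/z -natrM.
have zp : 0 < z by lra.
have pw : 0 < n%:R `^ theta by rewrite powR_gt0.
have -> : rho * (n%:R `^ theta * L n%:R) = z * n%:R `^ theta * (rho / z * L n%:R).
  by field; rewrite gt_eqF.
by apply: ler_wpM2l => //; rewrite mulr_ge0 // ltW.
Qed.

End Alpha.

(** * Expectations and exact occupancy counts *)

Section Expectation.
Context d (T : measurableType d) (R : realType) (P : probability T R).
Variables (X : nat -> {RV P >-> nat}) (hX : iid_labels X).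
Variable A : set R.
Hypothesis A01 : A `<=` `[0, 1].

Let q i : R := urn_prob X i.+1.
Let M n k := mocc q (size (balls A n)) k.

Lemma Rstar_occ n k x : Rstar A n k x = (occ (balls A n) k x)%:R.
Proof.
rewrite /Rstar /occ; congr (#|` fset_set _|%:R); apply/funext => i.
congr (_ /\ (k <= _)%N : Prop); rewrite /ball_count /hits -size_filter.
have fS : finite_set [set j | ball_indices A n j /\ x j = i].
  by apply: sub_finite_set (finite_balls n A01) => j [].
apply/perm_size/uniq_perm; [exact: fset_uniq|exact/filter_uniq/uniq_seq_of|].
have fB := finite_balls n A01.
move=> j; rewrite mem_filter (mem_seq_of j fB) (mem_seq_of j fS).
by apply/idP/idP; [move/set_mem => [h /eqP ->]; apply/mem_set|
  move=> /andP[/eqP e /set_mem h]; apply/mem_set].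
Qed.

Lemma balls_gt0 n : all (ltn 0) (balls A n).
Proof. by apply: seq_of_gt0; [exact: (finite_balls n A01)|move=> b []]. Qed.

Lemma integrable_occ J k : (0 < k)%N -> uniq J -> all (ltn 0) J ->
  P.-integrable setT (EFin \o (fun w => (occ J k (fun j => X j w))%:R : R)).
Proof.
move=> k0 uJ aJ; apply/integrableP; split.
  by apply/measurable_EFinP; exact: measurable_occ.
under eq_integral do rewrite /= ger0_norm //.
by rewrite integral_occ // ltry.
Qed.

Lemma expectation_Rstar n k : (0 < k)%N ->
  ('E_P[fun w => Rstar A n k (fun j => X j w)] = (M n k)%:E)%E.
Proof.
move=> k0; rewrite unlock; under eq_integral do rewrite Rstar_occ.
by rewrite integral_occ //; [exact: uniq_seq_of|exact: balls_gt0].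
Qed.

Lemma expectation_Rexact n k : (0 < k)%N ->
  ('E_P[fun w => Rexact A n k (fun j => X j w)] = (M n k - M n k.+1)%:E)%E.
Proof.
move=> k0; rewrite unlock; under eq_integral do rewrite /Rexact !Rstar_occ EFinB.
have uB : uniq (balls A n) by exact: uniq_seq_of.
have aB := balls_gt0 n.
rewrite integralB // ?integral_occ //; exact: integrable_occ.
Qed.

End Expectation.

(** The relative error of [u - v] is a combination of those of [u] and [v] with
    weights [a / (a - b)] and [b / (a - b)], both at most [1 / c]. *)
Lemma cvg_ratio_of_sub (R : realType) (u v a b : nat -> R) (c : R) : 0 < c ->
  (\forall n \near \oo, [/\ 0 < a n, 0 < b n, b n <= a n & c * a n <= a n - b n]) ->
  u n / a n @[n --> \oo] --> (1 : R) -> v n / b n @[n --> \oo] --> (1 : R) ->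
  (u n - v n) / (a n - b n) @[n --> \oo] --> (1 : R).
Proof.
move=> c0 H hu hv; apply/cvgrPdist_le => e e0.
have e2 : 0 < e * c / 2 by rewrite divr_gt0 // mulr_gt0.
move/cvgrPdist_le : hu => /(_ _ e2) hu; move/cvgrPdist_le : hv => /(_ _ e2) hv.
near=> n.
have [a0 b0 ba ca] : [/\ 0 < a n, 0 < b n, b n <= a n & c * a n <= a n - b n] by near: n.
have h1 : `|1 - u n / a n| <= e * c / 2 by near: n.
have h2 : `|1 - v n / b n| <= e * c / 2 by near: n.
have ab : 0 < a n - b n by apply: lt_le_trans ca; rewrite mulr_gt0.
have -> : 1 - (u n - v n) / (a n - b n) =
    (a n * (1 - u n / a n) - b n * (1 - v n / b n)) / (a n - b n).
  by field; rewrite !gt_eqF.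
rewrite normrM normfV (gtr0_norm ab) ler_pdivrMr //.
apply: le_trans (ler_normB _ _) _; rewrite !normrM (gtr0_norm a0) (gtr0_norm b0).
have h3 : a n * `|1 - u n / a n| <= a n * (e * c / 2) by rewrite ler_wpM2l // ltW.
have h4 : b n * `|1 - v n / b n| <= a n * (e * c / 2) by apply: ler_pM => //; exact: ltW.
apply: le_trans (lerD h3 h4) _.
have : e * (c * a n) <= e * (a n - b n) by rewrite ler_wpM2l // ltW.
by lra.
Unshelve. all: by end_near.
Qed.

Theorem theorem3 (d : measure_display) (T : measurableType d) (R : realType)
  (P : probability T R) (X : nat -> {RV P >-> nat}) (hX : iid_labels X)
  (hpos : forall i : nat, (0 < i)%N -> 0 < urn_prob X i)
  (hmon : forall i : nat, (0 < i)%N -> urn_prob X i.+1 <= urn_prob X i)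
  (theta : R) (htheta0 : 0 < theta) (htheta1 : theta <= 1)
  (L : R -> R) (hL : slowly_varying L)
  (halpha : forall x : R, 0 < x ->
     (alpha (urn_prob X) x)%:R = x `^ theta * L x)
  (k : nat) (hk : (0 < k)%N)
  (A : set R) (hA : Bfin A) (hA0 : (0 < lebesgue_measure A)%E) :
  {ae P, forall w : T,
    (Rstar A n k (fun j => X j w) /
       fine ('E_P[fun w' => Rstar A n k (fun j => X j w')])%E
     @[n --> \oo] --> (1 : R)) /\
    (Rexact A n k (fun j => X j w) /
       fine ('E_P[fun w' => Rexact A n k (fun j => X j w')])%E
     @[n --> \oo] --> (1 : R))}.
Proof.
have A01 := hA.1.
pose q i : R := urn_prob X i.+1.
have q_ge0 i : 0 <= q i by exact: urn_prob_ge0.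
have q_sum N : \sum_(0 <= i < N) q i <= 1 by exact: urn_prob_sum.
have [rho [n0 [rho1 n0p an0 dbl]]] :=
  alpha_doubling q_sum hmon htheta0 hL halpha (hpos 1%N isT).
pose a m := alpha (urn_prob X) m%:R.
have aP m i : (0 < m)%N -> (i < a m)%N = (1 <= m%:R * q i).
  by move=> m0; apply: (alphaP q_sum hmon); rewrite ltr0n.
have lln l : (0 < l)%N -> {ae P, forall w,
    (occ (balls A n) l (fun j => X j w))%:R / mocc q (size (balls A n)) l
      @[n --> \oo] --> (1 : R)}.
  move=> l0; have [C [c c0 [C0 H]]] := mocc_growth q_ge0 q_sum aP rho1 dbl n0p an0 l0.
  exact: occ_balls_lln hX _ _ _ _ _ hA hA0 l0 C0 c0 H.
have [c c0 Hc] := mocc_exact_ge q_ge0 q_sum aP rho1 dbl hk.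
have [delta d0 hd] := balls_size_ge hA hA0.
apply: filterS2 (lln k hk) (lln k.+1 (ltn0Sn k)) => w h1 h2.
split.
  by under eq_fun => n do rewrite (expectation_Rstar hX A01 n hk) (Rstar_occ A01).
under eq_fun => n do rewrite (expectation_Rexact hX A01 n hk) /Rexact !(Rstar_occ A01).
apply: (cvg_ratio_of_sub c0 _ h1 h2).
have pos m l : (0 < l)%N -> (n0 + 2 * l <= m)%N -> 0 < mocc q m l.
  move=> l0 hm; have [e e0 /(_ m hm) [_ h]] := mocc_exact_ge q_ge0 q_sum aP rho1 dbl l0.
  apply: lt_le_trans h; rewrite mulr_gt0 // ltr0n; apply: (@leq_trans (a n0)) => //.
  by apply: (threshold_homo q_ge0 aP) => //; lia.
have h0 : 0 <= (n0 + 2 * k.+1 + 1)%:R / delta by rewrite divr_ge0 // ltW.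
exists (maxn 1 (Num.bound ((n0 + 2 * k.+1 + 1)%:R / delta))) => // n /=.
rewrite geq_max => /andP[n1 hb].
have hn : (n0 + 2 * k.+1 <= size (balls A n))%N.
  rewrite -(ler_nat R); apply: le_trans (hd n n1).
  have : (n0 + 2 * k.+1 + 1)%:R / delta <= n%:R.
    by apply: le_trans (ltW (archi_boundP h0)) _; rewrite ler_nat.
  by rewrite ler_pdivrMr // natrD; lra.
have hn' : (n0 + 2 * k <= size (balls A n))%N by lia.
split; [exact: pos|exact: pos|exact: mocc_pred|].
by have [] := Hc _ hn'.
Qed.
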